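(* For every positive integer $n$ and every real $\alpha\ge 1$, the class of intersection graphs of systems of compact convex sets of aspect ratio at most $\alpha$ in $\mathbb{R}^n$ has asymptotic dimension at most $2n+1$.
   Context: The height of a subset $S\subseteq\mathbb{R}^n$ is the infimum of $h\ge 0$ such that $S$ is contained between two parallel hyperplanes at distance $h$; the aspect ratio of $S$ is the ratio of the diameter of $S$ to its height. For a system $\mathcal{S}$ of sets, its intersection graph has vertex set $\mathcal{S}$, with $S_1,S_2$ adjacent iff $S_1\cap S_2\neq\emptyset$. A graph $G$ is viewed as the metric space $(V(G),d_G)$ with $d_G$ the shortest-path distance. For a collection $\mathcal{U}$ of subsets of a metric space $(X,d)$, the Lebesgue number $L(\mathcal{U})$ is the supremum of $r\ge 0$ such that every ball $B(x,r)$ is contained in some $U\in\mathcal{U}$, and $\mathrm{mesh}(\mathcal{U})$ is the supremum of diameters of elements of $\mathcal{U}$. A function $D:\mathbb{R}_+\to\mathbb{R}_+$ is an $m$-dimensional control function for $(X,d)$ if for every $r>0$ there is a cover $\mathcal{U}=\bigcup_{i=1}^{m+1}\mathcal{U}_i$ of $X$ with $\mathrm{mesh}(\mathcal{U})\le D(r)$, $L(\mathcal{U})\ge r$, and the elements of each $\mathcal{U}_i$ pairwise disjoint. A class $\mathcal{G}$ of graphs has asymptotic dimension at most $m$ if some single function $D$ is an $m$-dimensional control function for every graph in $\mathcal{G}$. *)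

(* Defs.v *)
(* MathComp-Analysis. *)
From HB Require Import structures.
From mathcomp Require Import all_boot all_order all_algebra.
From mathcomp Require Import all_classical all_reals all_analysis.

Set Implicit Arguments.
Unset Strict Implicit.
Unset Printing Implicit Defensive.

Import Order.TTheory GRing.Theory Num.Theory numFieldNormedType.Exports.

Local Open Scope classical_set_scope.
Local Open Scope ring_scope.

(* Distances take values in \bar R, so that vertices in different components
   of a graph are at distance +oo. *)
Section ExtendedMetric.
Context {R : realType} {X : Type}.
Implicit Types (d : X -> X -> \bar R) (U : set X) (C : set (set X)).

Definition cball d (x : X) (r : R) : set X := [set y | (d x y <= r%:E)%E].

(* -oo on the empty set, which is harmless for the upper bounds below. *)
Definition diameter d U : \bar R :=
  ereal_sup [set t | exists x y, [/\ U x, U y & t = d x y]].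

Definition mesh d C : \bar R := ereal_sup [set diameter d U | U in C].

Definition lebesgue_number d C : \bar R :=
  ereal_sup [set r%:E | r in
    [set r : R | 0 <= r /\ forall x, exists2 U, C U & cball d x r `<=` U]].

Definition is_cover C : Prop := \bigcup_(U in C) U = [set: X].

Definition control_function (m : nat) d (D : {nonneg R} -> {nonneg R}) : Prop :=
  forall r : {nonneg R}, 0 < r%:num ->
    exists Us : 'I_m.+1 -> set (set X),
      let U := \bigcup_i Us i in
      [/\ is_cover U,
          (mesh d U <= (D r)%:num%:E)%E,
          (r%:num%:E <= lebesgue_number d U)%E
        & forall i, trivIset (Us i) id].

End ExtendedMetric.

Record graph := Graph {
  vertex : Type;
  adj : rel vertex;
  adj_sym : symmetric adj;
  adj_irr : irreflexive adj }.

Definition graph_dist (R : realType) (G : graph) (x y : vertex G) : \bar R :=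
  ereal_inf [set (size p)%:R%:E | p in
    [set p : seq (vertex G) | path (@adj G) x p /\ last x p = y]].

(* A class of graphs is a bare predicate: [set graph] would make the universe of
   vertex types smaller than that of [set], excluding sets of sets as vertices. *)
Definition asdim_at_most (R : realType) (CG : graph -> Prop) (m : nat) : Prop :=
  exists D : {nonneg R} -> {nonneg R},
    forall G : graph, CG G -> control_function m (@graph_dist R G) D.

Section IntersectionGraph.
Context {T : Type} (S : set (set T)).

(* The vertex type is the coercion of S to the subtype of its members. *)
Definition intersecting : rel S :=
  fun A B => `[< A <> B /\ val A `&` val B !=set0 >].

Lemma intersecting_sym : symmetric intersecting.
Proof.
move=> A B; apply/asbool_equiv_eq; rewrite setIC.
by split=> -[AB ?]; split=> // BA; exact: AB.
Qed.

Lemma intersecting_irr : irreflexive intersecting.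
Proof. by move=> A; apply/asboolP => -[]. Qed.

Definition intersection_graph : graph := Graph intersecting_sym intersecting_irr.

End IntersectionGraph.

Section Euclidean.
Context {R : realType} {n : nat}.
Implicit Types (u x y : 'rV[R]_n) (S : set 'rV[R]_n).

Definition dot x y : R := \sum_(i < n) x ord0 i * y ord0 i.

(* The norm that the library puts on matrices is the sup norm. *)
Definition eucl_norm x : R := Num.sqrt (dot x x).

Definition eucl_dist x y : \bar R := (eucl_norm (x - y))%:E.

(* For a unit normal u, the parallel hyperplanes dot u x = c and
   dot u x = c + h are at distance h. *)
Definition height S : \bar R :=
  ereal_inf [set h%:E | h in
    [set h : R | 0 <= h /\ exists u c, eucl_norm u = 1 /\
       forall x, S x -> c <= dot u x <= c + h]].

(* A set lying in a hyperplane (a single point, for instance) has height 0;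
   no finite bound on the aspect ratio is then satisfied. *)
Definition aspect_ratio S : \bar R :=
  (if height S == 0 then +oo else diameter eucl_dist S / height S)%E.

End Euclidean.

Definition convex_intersection_graphs (R : realType) (n : nat) (alpha : R)
    (G : graph) : Prop :=
  exists2 S : set (set 'rV[R]_n),
     forall A, S A ->
       [/\ compact A, convex_set A & (aspect_ratio A <= alpha%:E)%E]
     & G = intersection_graph S.

(* Main.v *)
Require Import Defs.
From mathcomp Require Import all_boot all_order all_algebra.
From mathcomp Require Import all_classical all_reals all_analysis.
From mathcomp Require Import perm zify ring lra.
Import Order.TTheory GRing.Theory Num.Theory numFieldNormedType.Exports.

(** Fix a radius r.  Use n + 1 shifted copies of a hierarchy of cubical grids,
    nested across scales, such that for each scale every point is deep inside
    its cell for one of the shifts.  Assign to a set A the scale of the largest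
    set within graph distance r of A, and a shift j for which A is deep at that
    scale; then no path of length r from A leaves the cell of A.  For fixed j
    this gives a tree decomposition of the sets of shift j (with edges between
    sets at distance at most r), indexed by the cells.  All sets of a bag are
    near a large set crossing a neighbourhood of the cell; large fat sets in a
    bounded region contain points of a coarse lattice, so each bag is a bounded
    union of cliques.  As for graphs of bounded treewidth, such a graph has
    asymptotic dimension at most 1, hence two colours suffice for each j, and
    2(n + 1) colours altogether.  The hierarchy needs finitely many scales; the
    general case is a limit, along an ultrafilter, of the colourings obtained
    for the sets of size in [K^-N, K^N). *)

(** * Graded distances, chains and unions of few cliques *)

Section Graded.
Context {X : Type}.

(* [nd k x y] stands for "the distance from x to y is at most k". *)
Record graded (nd : nat -> X -> X -> Prop) : Prop := Graded {
  nd_refl : forall x, nd 0 x x;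
  nd_sym : forall k x y, nd k x y -> nd k y x;
  nd_trans : forall k l x y z, nd k x y -> nd l y z -> nd (k + l)%N x z;
  nd_mono : forall k l x y, (k <= l)%N -> nd k x y -> nd l x y }.

Inductive chain (P : X -> Prop) (st : X -> X -> Prop) : X -> X -> Prop :=
| chain_one x : P x -> chain P st x x
| chain_cons x y z : P x -> st x y -> chain P st y z -> chain P st x z.

Lemma chainP_l {P st x y} : chain P st x y -> P x.
Proof. by case. Qed.

Lemma chainP_r {P st x y} : chain P st x y -> P y.
Proof. by elim. Qed.

Lemma chain_trans {P : X -> Prop} {st x y z} :
  chain P st x y -> chain P st y z -> chain P st x z.
Proof. by elim=> // a b c Pa ab _ IH /IH; apply: chain_cons. Qed.

Lemma chain_sym {P : X -> Prop} {st : X -> X -> Prop} {x y} :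
  (forall x y, st x y -> st y x) -> chain P st x y -> chain P st y x.
Proof.
move=> sts; elim=> [a Pa|a b c Pa ab bc cb]; first exact: chain_one.
apply: chain_trans cb (chain_cons _ _ _ _ _ (chainP_l bc) (sts _ _ ab) _).
exact: chain_one.
Qed.

Lemma chain_imp {P Q : X -> Prop} {st st' : X -> X -> Prop} {x y} :
  (forall x, P x -> Q x) -> (forall x y, P x -> P y -> st x y -> st' x y) ->
  chain P st x y -> chain Q st' x y.
Proof.
move=> PQ ss; elim=> [a Pa|a b c Pa ab bc IH]; first exact/chain_one/PQ.
exact: chain_cons (PQ _ Pa) (ss _ _ Pa (chainP_l bc) ab) IH.
Qed.

Lemma chain_last (P Q : X -> Prop) st x y : chain P st x y ->
  chain (fun u => P u /\ ~ Q u) st x y \/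
  exists b, [/\ P b, Q b & b = y \/
    exists2 b', st b b' & chain (fun u => P u /\ ~ Q u) st b' y].
Proof.
elim=> [a Pa|a b c Pa ab bc [IH|IH]]; last by right.
- by have [Qa|Qa] := EM (Q a); [right; exists a; split=> //; left|left; exact: chain_one].
- have [Qa|Qa] := EM (Q a); last by left; apply: chain_cons ab IH.
  by right; exists a; split=> //; right; exists b.
Qed.

Variables (nd : nat -> X -> X -> Prop).
Hypothesis nd_graded : graded nd.
Let ndr := nd_refl _ nd_graded.
Let nds := nd_sym _ nd_graded.
Let ndt := nd_trans _ nd_graded.
Let ndm := nd_mono _ nd_graded.

Definition nbh k (Z : X -> Prop) x := exists2 z, Z z & nd k x z.

Lemma nbh_mono k l Z x : (k <= l)%N -> nbh k Z x -> nbh l Z x.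
Proof. by move=> kl [z Zz xz]; exists z => //; apply: ndm xz. Qed.

Lemma nbh_nd {k l m Z x y} : nd k x y -> nbh l Z y -> (k + l <= m)%N -> nbh m Z x.
Proof. by move=> xy [z Zz yz] klm; exists z => //; apply: ndm klm (ndt _ _ _ _ _ xy yz). Qed.

(** The form in which bags are bounded: a union of [w] sets of diameter at most [e], instead of a
    cardinality. *)
Definition labelled e w (Z : X -> Prop) := exists f : X -> nat,
  (forall u, Z u -> f u < w)%N /\
  (forall u v, Z u -> Z v -> f u = f v -> nd e u v).

Lemma labelled_sub e w (Z Z' : X -> Prop) :
  (forall u, Z' u -> Z u) -> labelled e w Z -> labelled e w Z'.
Proof. by move=> s [f [f1 f2]]; exists f; split=> [u /s /f1|u v /s zu /s zv]; [|apply: f2]. Qed.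

Lemma labelled_drop e w (Z : X -> Prop) (f : X -> nat) q :
  (forall u, Z u -> f u < w.+1)%N ->
  (forall u v, Z u -> Z v -> f u = f v -> nd e u v) ->
  (q < w.+1)%N ->
  labelled e w (fun u => Z u /\ f u <> q).
Proof.
move=> f1 f2 qw; exists (fun u => unbump q (f u)); split.
  by move=> u [/f1 fu nq]; rewrite /unbump; lia.
move=> u v [Zu nu] [Zv nv]; rewrite /unbump => uv; apply: f2 => //; lia.
Qed.

Lemma labelled_nbh e w k (Z : X -> Prop) :
  labelled e w Z -> labelled (2 * k + e) w (nbh k Z).
Proof.
move=> [f [f1 f2]].
have /choice[g gP] : forall u, exists z, nbh k Z u -> Z z /\ nd k u z.
  by move=> u; have [[z Zz uz]|nu] := EM (nbh k Z u); [exists z|exists u].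
exists (f \o g); split=> [u /gP[/f1]//|u v /gP[Zu ugu] /gP[Zv vgv] /f2 fuv].
have := ndt _ _ _ _ _ (ndt _ _ _ _ _ ugu (fuv Zu Zv)) (nds _ _ _ vgv).
by apply: ndm; lia.
Qed.

(** Jump from [x] to the last vertex of the chain with the same label, at cost [e], and take one
    step; the rest avoids this label, so each label is paid for once. *)
Lemma labelled_chain e w rho P x y :
  labelled e w P -> chain P (nd rho) x y -> nd (w * (e + rho)) x y.
Proof.
elim: w P x => [|w IH] P x [f [f1 f2]] xy; first by have := f1 _ (chainP_l xy).
have Px := chainP_l xy.
have [cz|[b [Pb bx yb]]] := chain_last P (fun u => f u = f x) _ _ _ xy.
  by have [_ []] := chainP_l cz.
have xb : nd e x b by apply: f2.
case: yb => [<-|[b' bb' b'y]]; first by apply: ndm xb; nia.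
have {}IH := IH _ _ (labelled_drop _ _ _ _ _ f1 f2 (f1 _ Px)) b'y.
by have := ndt _ _ _ _ _ xb (ndt _ _ _ _ _ bb' IH); apply: ndm; nia.
Qed.

(** Excursions outside [An] cost at most [K], so the visits to [An] form a chain of longer steps;
    [K + rho] pays for what precedes the first visit and for what follows the last one. *)
Lemma chain_coarsen (P An : X -> Prop) rho K x y :
  (forall x y, chain (fun u => P u /\ ~ An u) (nd rho) x y -> nd K x y) ->
  chain P (nd rho) x y ->
  nd K x y \/ exists a a', [/\ nd (K + rho) x a,
    chain (fun u => P u /\ An u) (nd (K + 2 * rho)) a a' & nd (K + rho) a' y].
Proof.
move=> HK; set Pn := (fun u => P u /\ ~ An u) in HK *; set Pa := (fun u => P u /\ An u).
suff main : chain P (nd rho) x y -> chain Pn (nd rho) x y \/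
   exists a a', [/\ a = x \/ (exists2 x', chain Pn (nd rho) x x' & nd rho x' a),
    chain Pa (nd (K + 2 * rho)) a a' & nd (K + rho) a' y].
  move=> /main[/HK|[a [a' [xa aa' a'y]]]]; first by left.
  right; exists a, a'; split=> //.
  case: xa => [->|[x' /HK xx' x'a]]; first by apply: ndm (ndr x).
  exact: ndt x'a.
elim=> {x y} [x Px|x x1 y Px xx1 x1y].
  have [Ax|Ax] := EM (An x); last by left; exact: chain_one.
  right; exists x, x; split; [by left|exact: chain_one|by apply: ndm (ndr x)].
move=> [x1y'|[a [a' [x1a aa' a'y]]]].
  have [Ax|Ax] := EM (An x); last by left; apply: chain_cons xx1 x1y'.
  right; exists x, x; split; [by left|exact: chain_one|].
  by rewrite addnC; apply: ndt xx1 (HK _ _ x1y').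
right; have [Ax|Ax] := EM (An x).
  exists x, a'; split=> //; first by left.
  apply: chain_cons aa' => //.
  case: x1a => [->|[x' /HK xx' x'a]]; first by apply: ndm xx1; lia.
  by have := ndt _ _ _ _ _ xx1 (ndt _ _ _ _ _ xx' x'a); apply: ndm; lia.
exists a, a'; split=> //; right.
case: x1a => [->|[x' xx' x'a]]; first by exists x => //; exact: chain_one.
by exists x' => //; apply: chain_cons xx1 xx'.
Qed.

End Graded.

Lemma chain_retract {X : Type} (nd : nat -> X -> X -> Prop) (P Q : X -> Prop) k r x y :
  graded nd -> (forall u, P u -> exists2 v, Q v & nd r u v) ->
  chain P (nd k) x y ->
  exists x' y', [/\ nd r x x', nd r y y' & chain Q (nd (k + 2 * r)%N) x' y'].
Proof.
move=> gnd PQ; elim=> [u /PQ[v Qv uv]|u v z /PQ[u' Qu' uu'] uv _ [v' [z' [vv' zz' v'z']]]].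
  by exists v, v; split=> //; exact: chain_one.
exists u', z'; split=> //; apply: chain_cons v'z' => //.
have := nd_trans _ gnd _ _ _ _ _ (nd_sym _ gnd _ _ _ uu') (nd_trans _ gnd _ _ _ _ _ uv vv').
by apply: (nd_mono _ gnd); lia.
Qed.

(** * Tree systems and their two-colourings *)

(* A rooted tree decomposition in coordinates: its nodes are the pairs (i, g),
   the parent of (i, c i x) is (i + 1, c i.+1 x), the bag of (i, g) is the set
   in [ts_width], and x occurs in the bags of its cells at levels lo x to hi x.
   Geodesics may leave Y, but only near the hole O, where nothing is claimed. *)
Record tree_system {X C : Type} (nd : nat -> X -> X -> Prop) (w : nat)
    (Y O : X -> Prop) (lo hi : X -> nat) (c : nat -> X -> C) : Prop := TreeSystem {
  ts_graded : graded nd;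
  ts_lohi : forall u, Y u -> (lo u <= hi u)%N;
  ts_nest : forall i k x y, (i <= k)%N -> c i x = c i y -> c k x = c k y;
  ts_sep : forall m i x y, Y x -> Y y -> nd m x y -> ~ nbh nd m O x ->
    (lo x <= i)%N -> ~ ((lo y <= i)%N /\ c i x = c i y) ->
    exists a p q, [/\ Y a, (lo a <= i < hi a)%N, c i a = c i x, (p + q <= m)%N
      & nd p x a /\ nd q a y];
  ts_width : forall i g,
    labelled nd 1 w (fun u => [/\ Y u, (lo u <= i <= hi u)%N & c i u = g]) }.

Arguments ts_graded {X C nd w Y O lo hi c}.
Arguments ts_lohi {X C nd w Y O lo hi c}.
Arguments ts_nest {X C nd w Y O lo hi c}.
Arguments ts_sep {X C nd w Y O lo hi c}.
Arguments ts_width {X C nd w Y O lo hi c}.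

Definition bounded_classes {X : Type} (nd : nat -> X -> X -> Prop)
    (P : X -> Prop) (chi : X -> bool) rho D :=
  forall b x y, chain (fun u => P u /\ chi u = b) (nd rho) x y -> nd D x y.

(** [s] and [D] must not depend on the height [h], since the number of scales is unbounded. *)
Definition two_colorable w rho s D :=
  forall (X C : Type) (nd : nat -> X -> X -> Prop) (Y O : X -> Prop)
    (lo hi : X -> nat) (c : nat -> X -> C) h,
  tree_system nd w Y O lo hi c -> (forall u, Y u -> hi u < h)%N ->
  exists chi, bounded_classes nd (fun u => Y u /\ ~ nbh nd s O u) chi rho D.

(* Extension of a colouring given around a root bag Z0.  The part of the tree
   whose bags all meet the R-ball of Z0 loses one clique per bag when this ball
   is removed, so it is coloured by induction on the width, for the larger scale
   rho'.  Below it hang subtrees; around the adhesion set of such a subtree one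
   prescribes first the colours of the nearest adhesion points, then an annulus
   of [true], then an annulus of [false], and recurses with the top bag of the
   subtree as the new root.  A monochromatic chain entering the subtree cannot
   cross these annuli, so it is shadowed by a rho'-chain outside the subtree. *)
Section Extension.
Variables (w rho s' D' : nat).

(** [R] holds three layers of thickness [rho] around an adhesion set: copied colours and the two
    annuli. [D2] bounds chains staying within [2 * rho] of one bag; [rho'] is the step between the
    anchors in [Y0] that replace them. [D1] bounds the classes inside [Y0], and [D] adds both
    ends. *)
Let R := (3 * rho)%N.
Let D2 := (w.+1 * (2 * (2 * rho) + 1 + rho))%N.
Let rho' := (D2 + 2 * rho + 2 * rho)%N.
Let R2 := (R.+1 + s')%N.
Let D1 := (w.+1 * (2 * R2 + 1 + (D' + 2 * rho')) + 2 * (D' + rho'))%N.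
Let s := (s' + R)%N.
Let D := (D1 + 2 * rho + 2 * (D2 + rho))%N.

Hypothesis IHw : two_colorable w rho' s' D'.

Context {X C : Type} {nd : nat -> X -> X -> Prop}.
Variables (O : X -> Prop) (lo hi : X -> nat) (c : nat -> X -> C).

Section Step.
Variables (Y : X -> Prop) (h : nat).
Hypothesis tsY : tree_system nd w.+1 Y O lo hi c.
Hypothesis lo_h : forall u, Y u -> (lo u <= h)%N.

Let Z0 u := Y u /\ (h <= hi u)%N.
Hypothesis Z0_lab : labelled nd 1 w.+1 Z0.

Let gnd := ts_graded tsY.
Let ndr := nd_refl _ gnd.
Let nds := nd_sym _ gnd.
Let ndt := nd_trans _ gnd.
Let ndm := nd_mono _ gnd.
Let nest := ts_nest tsY.

Let Tb i g := exists a, [/\ Y a, (lo a <= i <= hi a)%N, c i a = g & nbh nd R Z0 a].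
Let Tup k u := forall j, (k <= j < h)%N -> Tb j (c j u).
(* The union of the bags coloured by induction on the width, together with Z0. *)
Let Y0 u := Y u /\ Tup (hi u) u.
(* u lies in the maximal uncoloured subtree rooted at (i, c i u). *)
Let F i u := [/\ (i < h)%N, (lo u <= i)%N, ~ Tb i (c i u) & Tup i.+1 u].

Local Lemma Tup_congr k j u v : (k <= j)%N -> c k u = c k v -> Tup j u -> Tup j v.
Proof.
move=> kj uv T i /andP[ji ih]; rewrite -(nest k i u v _ uv) ?(leq_trans kj ji) //.
by apply: T; rewrite ji.
Qed.

Local Lemma F_congr i u v : c i u = c i v -> (lo v <= i)%N -> F i u -> F i v.
Proof.
move=> uv vi [ih ui nT T]; split=> //; first by rewrite -uv.
exact: (Tup_congr _ _ _ _ (leqnSn i) uv T).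
Qed.

Local Lemma F_uniq i j u : F i u -> F j u -> i = j.
Proof.
move=> [ih _ ni Ti] [jh _ nj Tj].
case: (ltngtP i j) => // ij; exfalso.
  by apply: nj; apply: Ti; rewrite ij.
by apply: ni; apply: Tj; rewrite ij.
Qed.

Local Lemma F_exists k u : (lo u <= k)%N -> ~ Tup k u -> exists2 i, (k <= i)%N & F i u.
Proof.
move=> uk nT.
pose Q i := `[< (k <= i < h)%N /\ ~ Tb i (c i u) >].
have exQ : exists i, Q i.
  apply: contrapT => nQ; apply: nT => j jk; apply: contrapT => nj.
  by apply: nQ; exists j; apply/asboolP.
have Qh i : Q i -> (i <= h)%N by move=> /asboolP[]; lia.
case: (ex_maxnP exQ Qh) => i /asboolP[/andP[ki ih] nTi] imax.
exists i => //; split=> //; first exact: leq_trans ki.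
move=> j /andP[ij jh]; apply: contrapT => nj.
suff /imax : Q j by lia.
by apply/asboolP; split=> //; rewrite jh andbT; lia.
Qed.

Local Lemma Y0_child i u : F i u -> Y0 u -> (i < hi u)%N.
Proof.
move=> [ih ui nT _] [_ T]; rewrite ltnNge; apply/negP => hu.
by apply: nT; apply: T; rewrite hu.
Qed.

Local Lemma child_Y0 i u : F i u -> Y u -> (i < hi u)%N -> Y0 u.
Proof.
move=> [ih ui nT T] Yu iu; split=> // j /andP[uj jh].
by apply: T; rewrite jh andbT; apply: leq_trans uj.
Qed.

Local Lemma notY0 u : Y u -> ~ Y0 u -> exists i, F i u.
Proof.
move=> Yu nY0; have [|i _ Fi] := F_exists (hi u) u (ts_lohi tsY _ Yu).
  by move=> T; apply: nY0.
by exists i.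
Qed.

(** The radius is [R.+1] so that the hole swallows every vertex sharing a bag label with a vertex of
    the [R]-ball of [Z0]. *)
Let O' u := O u \/ nbh nd R.+1 Z0 u.
Let Y' u := Y0 u /\ ~ nbh nd R.+1 Z0 u.

(** Cutting off the subtree rooted at [(i, c i u)] makes [u] start at level [i.+1]. *)
Local Lemma raised_lo : exists lo' : X -> nat,
  (forall u, lo u <= h -> lo' u <= h)%N /\
  (forall u k, (k < h)%N -> (lo' u <= k)%N <-> (lo u <= k)%N /\ Tup k u).
Proof.
have /choice[lo' lo'P] : forall u, exists k, (exists2 i, F i u & k = i.+1) \/
    ((forall i, ~ F i u) /\ k = lo u).
  move=> u; have [[i Fi]|nF] := EM (exists i, F i u); first by exists i.+1; left; exists i.
  by exists (lo u); right; split=> // i Fi; apply: nF; exists i.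
exists lo'; split=> [u uh|u k kh].
  by case: (lo'P u) => [[i [ih _ _ _] ->]|[_ ->]].
case: (lo'P u) => [[i Fi ->]|[nF ->]].
  case: (Fi) => ih ui nT T; split=> [ik|[uk Tk]].
    split; first exact: leq_trans ui (ltnW ik).
    by move=> j /andP[kj jh]; apply: T; rewrite jh (leq_trans ik kj).
  rewrite ltnNge; apply/negP => ki; apply: nT; apply: Tk.
  by rewrite ki.
split=> [uk|[]//]; split=> //; apply: contrapT => nT.
by have [i _ Fi] := F_exists k u uk nT; apply: nF Fi.
Qed.

(** Every nonempty remaining bag has a member in the [R]-ball of [Z0]; its label disappears in the
    enlarged hole, which lowers the width. A separating vertex is within [m] of [x], hence not in
    the hole. *)
Local Lemma sub_system lo' :
  (forall u, lo u <= h -> lo' u <= h)%N ->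
  (forall u k, (k < h)%N -> (lo' u <= k)%N <-> (lo u <= k)%N /\ Tup k u) ->
  tree_system nd w Y' O' lo' hi c.
Proof.
move=> lo'h lo'P.
have hiY' u : Y' u -> (hi u < h)%N.
  move=> [[Yu _] nu]; rewrite ltnNge; apply/negP => hu; apply: nu.
  by exists u; [split|apply: ndm (ndr u)].
split=> //.
- move=> u Yu; have uh := hiY' _ Yu; case: Yu => [[Yu T] _].
  by apply/lo'P => //; split=> //; exact: (ts_lohi tsY).
- move=> m k x y Yx Yy xy nO xk nyk.
  have nOx : ~ nbh nd m O x.
    by move=> [t Ot xt]; apply: nO; exists t => //; left.
  have Z0far a p : (p <= m)%N -> nd p x a -> ~ nbh nd R.+1 Z0 a.
    by move=> pm xa na; apply: nO; exists a; [right|apply: ndm pm xa].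
  have [hk|kh] := leqP h k.
    have nyk' : ~ ((lo y <= k)%N /\ c k x = c k y).
      move=> [yk cxy]; apply: nyk; split=> //.
      by apply: leq_trans hk; apply: lo'h; apply: lo_h; case: Yy => -[].
    have [| | |a [p [q [Ya ka _ pq [xa _]]]]] := ts_sep tsY m k x y _ _ xy nOx _ nyk'.
    + by case: Yx => -[].
    + by case: Yy => -[].
    + by apply: leq_trans hk; apply: lo_h; case: Yx => -[].
    + case: (Z0far a p) => //; first by lia.
      by exists a; [split=> //; lia|apply: ndm (ndr a)].
  have [lxk Tx] := (lo'P x k kh).1 xk.
  have nyk' : ~ ((lo y <= k)%N /\ c k x = c k y).
    move=> [yk cxy]; apply: nyk; split=> //; apply/(lo'P y k kh); split=> //.
    exact: (Tup_congr _ _ _ _ (leqnn k) cxy Tx).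
  have [| |a [p [q [Ya /andP[ak ka] cax pq [xa ay]]]]] := ts_sep tsY m k x y _ _ xy nOx lxk nyk'.
    + by case: Yx => -[].
    + by case: Yy => -[].
  have Ta : Tup k a by apply: (Tup_congr _ _ _ _ (leqnn k) (esym cax) Tx).
  exists a, p, q; split=> //.
    split; last by apply: Z0far xa; lia.
    split=> // j /andP[aj jh]; apply: Ta; rewrite jh andbT; apply: leq_trans aj.
    exact: ltnW.
  by rewrite ka andbT; apply/(lo'P a k kh).
- move=> k g.
  have [f [f1 f2]] := ts_width tsY k g.
  have [[u [Yu uk cu]]|nu] :=
      EM (exists u, [/\ Y' u, (lo' u <= k <= hi u)%N & c k u = g]); last first.
    by exists (fun=> 0%N); split=> [u Yu|u v Yu]; case: nu; exists u.
  have kh : (k < h)%N by have := hiY' _ Yu; lia.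
  have [loku T] : (lo u <= k)%N /\ Tup k u by apply/lo'P => //; lia.
  have [q [Yq qk cq nq]] : Tb k g by rewrite -cu; apply: T; rewrite leqnn.
  have qb : [/\ Y q, (lo q <= k <= hi q)%N & c k q = g] by [].
  apply: labelled_sub (labelled_drop _ _ _ _ _ _ f1 f2 (f1 _ qb)) => v [[[Yv _] nv] vk cv].
  have vb : [/\ Y v, (lo v <= k <= hi v)%N & c k v = g].
    split=> //; have [] := (lo'P v k kh).1; lia.
  split=> // fvq; apply: nv.
  exact: (nbh_nd _ gnd (f2 _ _ vb qb fvq) nq (leqnn _)).
Qed.

(** Keep [chi0] on the ball and use the induction on the width elsewhere. Chains far from [Z0] are
    bounded by [D'], and the visits near [Z0] run in a neighbourhood of [w.+1] cliques. *)
Local Lemma color_Y0 (chi0 : X -> bool) : exists chiY : X -> bool,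
  (forall u, nbh nd R Z0 u -> chiY u = chi0 u) /\
  bounded_classes nd (fun u => Y0 u /\ ~ nbh nd s' O u) chiY rho' D1.
Proof.
have [lo' [lo'h lo'P]] := raised_lo.
have tsY' := sub_system lo' lo'h lo'P.
have hiY' u : Y' u -> (hi u < h)%N.
  move=> [[Yu _] nu]; rewrite ltnNge; apply/negP => hu; apply: nu.
  by exists u; [split|apply: ndm (ndr u)].
have [chi1 chi1P] := IHw _ _ _ _ _ _ _ _ _ tsY' hiY'.
exists (fun u => if `[< nbh nd R Z0 u >] then chi0 u else chi1 u); split=> [u nu|].
  by rewrite asboolT.
move=> b x y xy.
have far u v : chain (fun u => ((Y0 u /\ ~ nbh nd s' O u) /\
     (if `[< nbh nd R Z0 u >] then chi0 u else chi1 u) = b) /\ ~ nbh nd R2 Z0 u)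
    (nd rho') u v -> nd D' u v.
  move=> uv; apply: (chi1P b); apply: chain_imp uv => // z [[[Y0z nOz] zb] nz].
  have nR k : (k <= R2)%N -> ~ nbh nd k Z0 z.
    by move=> kR nk; apply: nz; apply: (nbh_mono _ gnd _ _ _ _ _ nk).
  split; last by move: zb; rewrite asboolF //; apply: nR; rewrite /R2; lia.
  split; first by split=> //; apply: nR; rewrite /R2; lia.
  move=> [t [Ot|no] zo]; first by apply: nOz; exists t.
  by apply: nz; apply: (nbh_nd _ gnd zo no); rewrite /R2; lia.
have [xyD|[a [a' [xa aa' a'y]]]] := chain_coarsen _ gnd _ _ _ _ _ _ far xy.
  by apply: ndm xyD; rewrite /D1; lia.
have lab : labelled nd (2 * R2 + 1) w.+1 (nbh nd R2 Z0) by exact: labelled_nbh.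
have {}aa' : nd (w.+1 * (2 * R2 + 1 + (D' + 2 * rho'))) a a'.
  by apply: (labelled_chain _ gnd _ _ _ _ _ _ lab); apply: chain_imp aa' => // u [].
have := ndt _ _ _ _ _ xa (ndt _ _ _ _ _ aa' a'y).
by apply: ndm; rewrite /D1; lia.
Qed.

(* The vertices in bags at or below the node (i, g). *)
Let Ych i g u := [/\ Y u, (lo u <= i)%N & c i u = g].

Local Lemma child_system i g : tree_system nd w.+1 (Ych i g) O lo hi c.
Proof.
split=> //; first by move=> u [Yu _ _]; exact: (ts_lohi tsY).
- move=> m k x y [Yx xi xg] [Yy yi yg] xy nO xk nyk.
  have [a [p [q [Ya ak ca pq xay]]]] := ts_sep tsY m k x y Yx Yy xy nO xk nyk.
  have ki : (k <= i)%N.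
    rewrite leqNgt; apply/negP => ik; apply: nyk; split; first by lia.
    by apply: (nest i); [exact: ltnW|rewrite xg yg].
  exists a, p, q; split=> //; split=> //; first by lia.
  by rewrite (nest k i a x).
- move=> k g'; apply: labelled_sub (ts_width tsY k g').
  by move=> u [[Yu _ _] uk cu].
Qed.

Hypothesis IHh : forall i g (chi0 : X -> bool), (i < h)%N -> exists chi : X -> bool,
  (forall u, Ych i g u -> nbh nd R (fun v => Ych i g v /\ (i <= hi v)%N) u ->
     ~ nbh nd s O u -> chi u = chi0 u) /\
  bounded_classes nd (fun u => Ych i g u /\ ~ nbh nd s O u) chi rho D.

(* The adhesion set of the node (i, g) and its parent. *)
Let A i g a := [/\ Y a, (lo a <= i < hi a)%N & c i a = g].

Local Lemma nbh_A_bag k i g u : nbh nd k (A i g) u ->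
  nbh nd k (fun v => Ych i g v /\ (i <= hi v)%N) u.
Proof. by move=> [a [Ya ia ca] ua]; exists a => //; split; [split|]=> //; lia. Qed.

Local Lemma crossing i u v k : Y u -> Y v -> (k <= s)%N -> ~ nbh nd s O u -> nd k u v ->
  (lo u <= i)%N -> ~ ((lo v <= i)%N /\ c i u = c i v) ->
  exists a p q, [/\ A i (c i u) a, (p + q <= k)%N, nd p u a & nd q a v].
Proof.
move=> Yu Yv ks nO uv ui nv.
have nOk : ~ nbh nd k O u by move=> nk; apply: nO; apply: (nbh_mono _ gnd _ _ _ _ _ nk).
have [a [p [q [Ya ia ca pq [ua av]]]]] := ts_sep tsY k i u v Yu Yv uv nOk ui nv.
by exists a, p, q; split.
Qed.

Local Lemma extend_step (chi0 : X -> bool) : exists chi : X -> bool,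
  (forall u, Y u -> nbh nd R Z0 u -> ~ nbh nd s O u -> chi u = chi0 u) /\
  bounded_classes nd (fun u => Y u /\ ~ nbh nd s O u) chi rho D.
Proof.
have [chiY [chiY0 chiYP]] := color_Y0 chi0.
(* [an] retracts the [rho]-neighbourhood of an adhesion set onto it; as it fixes the adhesion set,
   the prescribed colours agree with [chiY] there. *)
have /choice[an anP] : forall igu : nat * C * X, exists a, let: (i, g, u) := igu in
    (A i g u -> a = u) /\ (nbh nd rho (A i g) u -> A i g a /\ nd rho u a).
  move=> [[i g] u]; have [Au|nAu] := EM (A i g u).
    by exists u; split=> // _; split=> //; apply: ndm (ndr u).
  have [[a Aa ua]|nu] := EM (nbh nd rho (A i g) u); first by exists a.
  by exists u.
pose pre i g u := if `[< nbh nd rho (A i g) u >] then chiY (an (i, g, u))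
                  else `[< nbh nd (2 * rho) (A i g) u >].
have /choice[chit chitP] : forall ig : nat * C, exists chi : X -> bool,
    (ig.1 < h)%N ->
    (forall u, Ych ig.1 ig.2 u -> nbh nd R (fun v => Ych ig.1 ig.2 v /\ (ig.1 <= hi v)%N) u ->
     ~ nbh nd s O u -> chi u = pre ig.1 ig.2 u) /\
    bounded_classes nd (fun u => Ych ig.1 ig.2 u /\ ~ nbh nd s O u) chi rho D.
  move=> [i g] /=; have [ih|hi'] := ltnP i h; last by exists xpredT.
  by have [chi chiP] := IHh i g (pre i g) ih; exists chi.
have /choice[lev levP] : forall u, exists i, (exists j, F j u) -> F i u.
  by move=> u; have [[i Fi]|nF] := EM (exists j, F j u); [exists i|exists 0%N].
pose chi u := if `[< Y0 u >] then chiY u else chit (lev u, c (lev u) u) u.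
have levE i u : F i u -> lev u = i.
  by move=> Fi; exact: F_uniq (levP u (ex_intro _ i Fi)) Fi.
have chi_child i u : Y u -> ~ nbh nd s O u -> F i u -> chit (i, c i u) u = chi u.
  move=> Yu nO Fi; rewrite /chi; case: asboolP => [Y0u|_]; last by rewrite (levE i).
  have iu := Y0_child _ _ Fi Y0u.
  case: (Fi) => ih ui _ _.
  have Au : A i (c i u) u by split=> //; rewrite ui.
  rewrite (chitP (i, c i u) ih).1 //=.
  - rewrite /pre asboolT; last by exists u => //; apply: ndm (ndr u).
    by rewrite (anP (i, c i u, u)).1.
  - by apply: nbh_A_bag; exists u => //; apply: ndm (ndr u).
have chi_pre i u : Y u -> ~ nbh nd s O u -> F i u -> nbh nd R (A i (c i u)) u ->
    chi u = pre i (c i u) u.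
  move=> Yu nO Fi nA; rewrite -(chi_child i) //.
  case: (Fi) => ih ui _ _.
  by rewrite (chitP (i, c i u) ih).1 //=; apply: nbh_A_bag.
exists chi; split.
  move=> u Yu nZ nO; rewrite /chi; case: asboolP => [_|nY0]; first exact: chiY0.
  (* A path of length [R] from [u] to [Z0] would meet the top bag of the subtree of [u] inside the
     [R]-ball, which this bag misses by [F]. *)
  have [i Fi] := notY0 _ Yu nY0; exfalso.
  case: (Fi) (nZ) => ih ui nT _ [z Z0z uz].
  have [zi|nz] := EM ((lo z <= i)%N /\ c i u = c i z).
    apply: nT; exists z; case: Z0z zi => Yz hz [zi cz]; split=> //; first by lia.
    by exists z => //; apply: ndm (ndr z).
  have [| |a [p [q [[Ya ia ca] pq ua az]]]] := crossing i u z R Yu _ _ nO uz ui nz.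
  - by case: Z0z.
  - by rewrite /s; lia.
  apply: nT; exists a; split=> //; first by lia.
  by exists z => //; apply: ndm az; lia.
pose G b u := (Y u /\ ~ nbh nd s O u) /\ chi u = b.
(* Colour [true] cannot cross the annulus of [false] beyond [2 * rho], nor colour [false] the
   annulus of [true] beyond [rho]. Hence a violation of [Inv] propagates along a chain, inside one
   subtree. *)
pose Inv (b : bool) i u := nbh nd (if b then 2 * rho else rho) (A i (c i u)) u.
have cross b i u v : G b u -> Y v -> F i u -> nd rho u v ->
    ~ ((lo v <= i)%N /\ c i u = c i v) -> nbh nd rho (A i (c i u)) u.
  move=> [[Yu nO] _] Yv [_ ui _ _] uv nv.
  have [|a [p [q [Aa pq ua _]]]] := crossing i u v rho Yu Yv _ nO uv ui nv.
    by rewrite /s /R; lia.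
  by exists a => //; apply: ndm ua; lia.
have bad_step b i u v : G b u -> G b v -> nd rho u v -> F i u -> ~ Inv b i u ->
    [/\ F i v, c i v = c i u & ~ Inv b i v].
  move=> Gu Gv uv Fi nI.
  have [[vi cuv]|nv] := EM ((lo v <= i)%N /\ c i u = c i v); last first.
    case: nI; have nr := cross _ _ _ _ Gu Gv.1.1 Fi uv nv.
    by apply: (nbh_mono _ gnd _ _ _ _ _ nr) => //; case: b {Gu Gv}; lia.
  split=> //; first exact: F_congr Fi.
  move=> Iv; apply: nI; case: Gu => [[Yu nO] ub].
  rewrite /Inv -cuv in Iv *.
  have nu := nbh_nd _ gnd uv Iv (leqnn _).
  have := chi_pre i u Yu nO Fi; rewrite ub /pre.
  case: asboolP => [nrho _|nnrho].
    by apply: (nbh_mono _ gnd _ _ _ _ _ nrho) => //; case: (b); lia.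
  case: asboolP => [n2 bt|nn2 bt].
    by move: nu; rewrite bt //; apply: (nbh_mono _ gnd _ _ _ _ _ n2) => //; rewrite /R; lia.
  move: nu; case: (b) bt => bt nu; last by case: nn2; apply: (nbh_mono _ gnd _ _ _ _ _ nu) => //; lia.
  by have /bt : nbh nd R (A i (c i u)) u by apply: (nbh_mono _ gnd _ _ _ _ _ nu) => //; rewrite /R; lia.
move=> b x y xy.
pose Bad u := exists2 i, F i u & ~ Inv b i u.
(* A chain with a bad start stays in one subtree, where [IHh] bounds it. By symmetry, a chain with a
   good start has no bad vertex. *)
have [[i Fi nI]|nBad] := EM (Bad x).
  have ih : (i < h)%N by case: Fi.
  apply: ((chitP (i, c i x) ih).2 b) => /=.
  elim: xy Fi nI => [u [[Yu nO] ub] Fi nI|u v z Gu uv vz IH Fi nI].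
    apply: chain_one; split; last by rewrite chi_child.
    by split=> //; case: Fi => _ ui _ _.
  have Gv := chainP_l vz.
  have [Fv cv nIv] := bad_step b i u v Gu Gv uv Fi nI.
  have := IH Fv nIv; rewrite cv; apply: chain_cons => //.
  case: Gu => [[Yu nO] ub].
  split; last by rewrite chi_child.
  by split=> //; case: Fi => _ ui _ _.
pose P u := G b u /\ ~ Bad u.
have {xy nBad} xy : chain P (nd rho) x y.
  elim: xy nBad => [u Gu nB|u v z Gu uv vz IH nB]; first exact: chain_one.
  apply: chain_cons (uv) _; first by [].
  apply: IH => -[i Fi nI]; apply: nB.
  have [Fu cu nIu] := bad_step b i v u (chainP_l vz) Gu (nds _ _ _ uv) Fi nI.
  by exists i.
(* Vertices of [An] have an anchor in [Y0] of the same colour within [rho]. Between visits to [An]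
   the chain floats in one subtree, within [2 * rho] of its adhesion set, hence of one bag. *)
pose An u := Y0 u \/ exists2 i, F i u & nbh nd rho (A i (c i u)) u.
have floats u v : chain (fun u => P u /\ ~ An u) (nd rho) u v -> nd D2 u v.
  move=> uv.
  have [[[[Yu _] _] _] nAn] := chainP_l uv.
  have [|i Fi] := notY0 u Yu; first by move=> Y0u; apply: nAn; left.
  have lab : labelled nd (2 * (2 * rho) + 1) w.+1
      (nbh nd (2 * rho) (fun v => [/\ Y v, (lo v <= i <= hi v)%N & c i v = c i u])).
    by apply: labelled_nbh => //; exact: (ts_width tsY).
  apply: (labelled_chain _ gnd _ _ _ _ _ _ lab) => {Yu nAn lab}.
  have mem z : P z /\ ~ An z -> F i z ->
      nbh nd (2 * rho) (fun v => [/\ Y v, (lo v <= i <= hi v)%N & c i v = c i z]) z.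
    move=> [[Gz nB] nAn] Fz.
    have : Inv b i z by apply: contrapT => nI; apply: nB; exists i.
    rewrite /Inv => -[a [Ya ia ca] za]; exists a; first by split=> //; lia.
    by apply: ndm za; case: (b); lia.
  elim: uv Fi => [z /mem Pz /Pz|z t y' Pz zt ty' IH Fz]; first exact: chain_one.
  have Pt := chainP_l ty'.
  have [[ti ct]|nt] := EM ((lo t <= i)%N /\ c i z = c i t); last first.
    case: Pz => [[Gz _] []]; right; exists i => //.
    exact: cross Gz Pt.1.1.1.1 Fz zt nt.
  apply: chain_cons zt _; first exact: mem.
  by rewrite ct; apply: IH; exact: F_congr Fz.
have anchor u : P u /\ An u ->
    exists2 v, (Y0 v /\ ~ nbh nd s' O v) /\ chiY v = b & nd rho u v.
  move=> [[[[Yu nO] ub] _] An_u].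
  have nO' v : nd rho u v -> ~ nbh nd s' O v.
    by move=> uv nv; apply: nO; apply: (nbh_nd _ gnd uv nv); rewrite /s /R; lia.
  have [Y0u|nY0] := EM (Y0 u).
    have uu : nd rho u u by apply: ndm (ndr u).
    exists u => //; split; first by split=> //; exact: nO'.
    by rewrite -ub /chi asboolT.
  case: An_u => // -[i Fi nA].
  have [Aa ua] := (anP (i, c i u, u)).2 nA.
  exists (an (i, c i u, u)) => //; split.
    split; last exact: nO'.
    case: Aa => Ya /andP[ai ia] ca.
    by apply: child_Y0 ia => //; apply: F_congr Fi.
  rewrite -ub (chi_pre i) //; last by apply: (nbh_mono _ gnd _ _ _ _ _ nA) => //; rewrite /R; lia.
  by rewrite /pre asboolT.
have [xyD|[a [a' [xa aa' a'y]]]] := chain_coarsen _ gnd _ _ _ _ _ _ floats xy.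
  by apply: ndm xyD; rewrite /D; lia.
have [v [v' [av a'v' vv']]] := chain_retract _ _ _ _ _ _ _ gnd anchor aa'.
have {}vv' : nd D1 v v' := chiYP b v v' vv'.
have aa := ndt _ _ _ _ _ (ndt _ _ _ _ _ av vv') (nds _ _ _ a'v').
have := ndt _ _ _ _ _ (ndt _ _ _ _ _ xa aa) a'y.
by apply: ndm; rewrite /D; lia.
Qed.

End Step.

Lemma extend_coloring h (Y : X -> Prop) (chi0 : X -> bool) :
  tree_system nd w.+1 Y O lo hi c -> (forall u, Y u -> lo u <= h)%N ->
  labelled nd 1 w.+1 (fun u => Y u /\ (h <= hi u)%N) ->
  exists chi : X -> bool,
  (forall u, Y u -> nbh nd R (fun u => Y u /\ (h <= hi u)%N) u ->
     ~ nbh nd s O u -> chi u = chi0 u) /\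
  bounded_classes nd (fun u => Y u /\ ~ nbh nd s O u) chi rho D.
Proof.
elim/ltn_ind: h Y chi0 => h IH Y chi0 tsY loh lab.
apply: extend_step => // i g chi1 ih; apply: IH => //.
- exact: child_system.
- by move=> u [].
- apply: labelled_sub (ts_width tsY i g) => u [[Yu ui cu] iu].
  by rewrite ui.
Qed.

End Extension.

Lemma two_colorable_exists w rho : exists s D, two_colorable w rho s D.
Proof.
elim: w rho => [|w IHw] rho.
  exists 0%N, 0%N => X C nd Y O lo hi c h ts hih; exists xpredT => b x y xy.
  have [[Yx _] _] := chainP_l xy.
  have [f [f1 _]] := ts_width ts (lo x) (c (lo x) x).
  by suff : (f x < 0)%N by []; apply: f1; rewrite leqnn (ts_lohi ts).
have [s' [D' H]] := IHw (w.+1 * (2 * (2 * rho) + 1 + rho) + 2 * rho + 2 * rho)%N.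
eexists; eexists => X C nd Y O lo hi c h ts hih.
(* The root is placed at level [h], above every [hi u], so that its bag is empty and the prescribed
   colouring is arbitrary. *)
have [| |chi [_ chiP]] := extend_coloring w rho s' D' H O lo hi c h Y xpredT ts.
- by move=> u Yu; apply: leq_trans (ts_lohi ts _ Yu) (ltnW (hih _ Yu)).
- by exists (fun=> 0%N); split=> // u v [/hih]; lia.
- by exists chi; exact: chiP.
Qed.

(** * Fatness of convex sets of bounded aspect ratio *)

Local Open Scope classical_set_scope.
Local Open Scope ring_scope.

Section Convex.
Context {R : realType} {V : lmodType R}.
Variable A : set V.
Hypothesis cvxA : convex_set A.

Lemma convex_comb x y t : A x -> A y -> 0 <= t <= 1 -> A (t *: x + (1 - t) *: y).
Proof.
move=> Ax Ay /andP[t0 t1].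
by have := cvxA x y (Itv01 t0 t1); rewrite !inE; exact.
Qed.

Lemma convex_sum m (a : 'I_m -> R) (p : 'I_m -> V) : (forall i, 0 <= a i) ->
  (forall i, A (p i)) -> \sum_i a i = 1 -> A (\sum_i a i *: p i).
Proof.
move=> a0 Ap a1; case: m a p a0 Ap a1 => [|m] a p a0 Ap a1.
  by move: a1; rewrite big_ord0 => /eqP; rewrite eq_sym oner_eq0.
suff [_ [y Ay ->]] : 0 <= \sum_i a i /\ exists2 y, A y & \sum_i a i *: p i = (\sum_i a i) *: y.
  by rewrite a1 scale1r.
apply: (big_rec2 (fun x s => 0 <= s /\ exists2 y, A y & x = s *: y)).
  by split=> //; exists (p ord0); rewrite ?scale0r.
move=> i x s _ [s0 [y Ay ->]]; split; first by rewrite addr_ge0.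
have [as0|as_neq0] := eqVneq (a i + s) 0.
  have [-> ->] : a i = 0 /\ s = 0 by have := a0 i; split; lra.
  by exists y => //; rewrite addr0 !scale0r addr0.
have as_gt0 : 0 < a i + s by rewrite lt_def as_neq0 addr_ge0.
exists (a i / (a i + s) *: p i + (1 - a i / (a i + s)) *: y).
  apply: convex_comb => //.
  by rewrite divr_ge0 ?(ltW as_gt0)//= ler_pdivrMr// mul1r lerDl.
rewrite scalerDr !scalerA; congr (_ *: _ + _ *: _); by field.
Qed.

End Convex.

Section Inball.
Context {R : realType} {n : nat}.
Implicit Types (u v x y z : 'rV[R]_n).

Lemma dotE u x : dot u x = (u *m x^T) 0 0.
Proof. by rewrite mxE; apply: eq_bigr => i _; rewrite mxE. Qed.

Lemma dotZl (k : R) u x : dot (k *: u) x = k * dot u x.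
Proof. by rewrite !dotE -scalemxAl mxE. Qed.

Lemma dotBr u x y : dot u (x - y) = dot u x - dot u y.
Proof. by rewrite !dotE linearB mulmxBr !mxE. Qed.

Lemma dot_ge0 u : 0 <= dot u u.
Proof. by apply: sumr_ge0 => i _; rewrite -expr2 sqr_ge0. Qed.

Lemma coord_le_norm u i : `|u 0 i| <= eucl_norm u.
Proof.
rewrite -sqrtr_sqr ler_sqrt ?dot_ge0// /dot (bigD1 i)//= expr2 lerDl.
by apply: sumr_ge0 => j _; rewrite -expr2 sqr_ge0.
Qed.

Lemma eucl_norm_gt0 u : u != 0 -> 0 < eucl_norm u.
Proof.
move=> u0; have [i ui] : exists i, u 0 i != 0.
  apply: contrapT => nu; move/eqP: u0; apply; apply/rowP => i; rewrite mxE.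
  by apply/eqP/negPn/negP => ui; apply: nu; exists i.
by apply: lt_le_trans (coord_le_norm u i); rewrite normr_gt0.
Qed.

Lemma eucl_normZ (k : R) u : 0 <= k -> eucl_norm (k *: u) = k * eucl_norm u.
Proof.
move=> k0; rewrite /eucl_norm dotZl dotE linearZ -scalemxAr mxE -dotE mulrA.
by rewrite -expr2 sqrtrM ?sqr_ge0// sqrtr_sqr ger0_norm.
Qed.

Variables (A : set 'rV[R]_n) (v0 : 'rV[R]_n) (M eta : R).
Hypotheses (cvxA : convex_set A) (Av0 : A v0)
  (A_bnd : forall x i, A x -> `|x 0 i| <= M) (eta0 : 0 < eta)
  (A_width : forall u c h, eucl_norm u = 1 -> 0 <= h ->
     (forall x, A x -> c <= dot u x <= c + h) -> eta <= h).

Lemma width_le u c h : 0 <= h -> (forall x, A x -> c <= dot u x <= c + h) ->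
  eta * eucl_norm u <= h.
Proof.
move=> h0 uA; have [->|u0] := eqVneq u 0.
  rewrite /eucl_norm /dot big1 ?sqrtr0 ?mulr0// => i _.
  by rewrite mxE mul0r.
have Nu := eucl_norm_gt0 u u0.
rewrite -ler_pdivlMr//; apply: (A_width ((eucl_norm u)^-1 *: u) (c / eucl_norm u)).
- by rewrite eucl_normZ ?invr_ge0 ?(ltW Nu)// mulVf// gt_eqF.
- by rewrite divr_ge0// ltW.
- move=> x /uA /andP[cx xc]; rewrite dotZl [_^-1 * _]mulrC.
  by rewrite -mulrDl !ler_pM2r ?invr_gt0// cx.
Qed.

Let simplex m (E : 'M[R]_(m, n)) := forall k, A (v0 + row k E).

(** A nonzero [u] orthogonal to the rows found so far is not constant on [A], which has positive
    width in direction [u]; this gives the next row. *)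
Lemma free_simplex k : (k <= n)%N -> exists2 E : 'M[R]_(k, n), simplex _ E & row_free E.
Proof.
elim: k => [|k IH] kn.
  by exists 0; [move=> [] | rewrite -row_leq_rank].
have [E sE fE] := IH (ltnW kn).
have [u [u0 uE]] : exists u : 'rV_n, u != 0 /\ E *m u^T = 0.
  have : kermx E^T != 0.
    rewrite kermx_eq0 -row_leq_rank mxrank_tr (eqP fE) -ltnNge; exact: kn.
  move=> /rowV0Pn[u /sub_kermxP uE u0]; exists u; split=> //.
  by rewrite -[E]trmxK -trmx_mul uE trmx0.
have [x Ax xu] : exists2 x, A x & dot u (x - v0) != 0.
  apply: contrapT => nx.
  have : eta * eucl_norm u <= 0.
    apply: (width_le u (dot u v0) 0) => // x Ax; rewrite addr0.
    suff : dot u (x - v0) = 0 by rewrite dotBr => /eqP; rewrite subr_eq0 => /eqP ->; rewrite lexx.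
    by apply/eqP/negPn/negP => xu; apply: nx; exists x.
  by rewrite leNgt mulr_gt0// eucl_norm_gt0.
rewrite -addn1; exists (col_mx E (x - v0)).
  move=> i; case: (split_ordP i) => j ->; first by rewrite rowKu.
  by rewrite rowKd (ord1 j) row_id subrKC.
rewrite -kermx_eq0; apply/eqP/row_matrixP => i; rewrite row0.
set r := row i _.
have : r *m col_mx E (x - v0) = 0 by rewrite -row_mul mulmx_ker row0.
rewrite -[r]hsubmxK mul_row_col => r0.
have r2 : rsubmx r = 0.
  have := congr1 (fun X => (X *m u^T) 0 0) r0.
  rewrite mulmxDl -!mulmxA uE mulmx0 add0r mul0mx [rsubmx r]mx11_scalar.
  rewrite mul_scalar_mx mxE [RHS]mxE => /eqP.
  rewrite mulf_eq0 => /orP[/eqP->|]; first by rewrite raddf0.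
  have -> : ((x - v0) *m u^T) 0 0 = dot u (x - v0).
    by rewrite dotE -[x - v0 in LHS]trmxK -trmx_mul mxE.
  by rewrite (negbTE xu).
move: r0; rewrite r2 mul0mx addr0 => /eqP; rewrite mulmx_free_eq0// => /eqP ->.
by rewrite row_mx0.
Qed.

Definition subst_row k x (E : 'M[R]_n) : 'M[R]_n :=
  \matrix_(i, j) if i == k then x 0 j else E i j.

Lemma det_subst_row k x (E : 'M[R]_n) :
  \det (subst_row k x E) = \sum_j x 0 j * cofactor E k j.
Proof.
rewrite (expand_det_row _ k); apply: eq_bigr => j _; rewrite mxE eqxx; congr (_ * _).
rewrite /cofactor; congr (_ * \det _); apply/matrixP => a b.
by rewrite !mxE eq_sym (negbTE (neq_lift _ _)).
Qed.

(* A simplex of almost maximal volume: all of A has barycentric coordinates of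
   size at most 2 with respect to it, so a lower bound on the width of A bounds
   its facets' distances from below. *)
Lemma max_simplex : exists2 E : 'M[R]_n, simplex _ E /\ \det E != 0 &
  forall F, simplex _ F -> `|\det F| <= 2 * `|\det E|.
Proof.
have [E0 sE0 fE0] := free_simplex n (leqnn n).
have dE0 : 0 < `|\det E0| by rewrite normr_gt0 -unitfE -unitmxE -row_free_unit.
pose S := [set d | exists2 E, simplex _ E & d = `|\det E|].
have SE0 : S `|\det E0| by exists E0.
have S_bnd : has_ubound S.
  exists (\sum_(s : 'S_n) (2 * M) ^+ n) => _ [E sE ->].
  apply: le_trans (ler_norm_sum _ _ _) _; apply: ler_sum => s _.
  rewrite normrM normrX normrN1 expr1n mul1r normr_prod.
  rewrite -[X in _ <= _ ^+ X]card_ord -prodr_const; apply: ler_prod => i _.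
  rewrite normr_ge0 /=.
  have -> : E i (s i) = (v0 + row i E) 0 (s i) - v0 0 (s i) by rewrite !mxE addrC addKr.
  apply: le_trans (ler_normB _ _) _.
  by have := A_bnd _ (s i) Av0; have := A_bnd _ (s i) (sE i); lra.
have supE0 : `|\det E0| <= sup S by apply: ub_le_sup.
have hs : has_sup S by split=> //; exists `|\det E0|.
have [|_ [E sE ->] Esup] := @sup_adherent _ _ (sup S / 2) _ hs; first by lra.
exists E => [|F sF].
  by split=> //; rewrite -normr_gt0; lra.
have : `|\det F| <= sup S by apply: ub_le_sup => //; exists F.
lra.
Qed.

(** [g] is the centroid of the almost maximal simplex. Each [phi k] varies by at most 4 over [A], so
    its norm is at most [4 / eta], and [z] moves each of the [n] coordinates along the rows of [E]
    by at most [1 / n.+1 ^ 2]; these and the weight of [v0] stay nonnegative. *)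
Lemma inball : (0 < n)%N -> exists2 g, A g &
  forall z, (forall i, `|z 0 i| <= eta / (4 * n%:R * n.+1%:R ^+ 2)) -> A (g + z).
Proof.
move=> n0; have [E [sE dE] maxE] := max_simplex.
(* [phi k] is the k-th coordinate functional of the basis formed by the rows of E. *)
pose phi k := \row_j (cofactor E k j / \det E).
have phiE k x : dot (phi k) x = \det (subst_row k x E) / \det E.
  rewrite det_subst_row mulr_suml; apply: eq_bigr => j _; rewrite mxE; ring.
have phiA k x : A x -> `|dot (phi k) (x - v0)| <= 2.
  move=> Ax; rewrite phiE normrM normfV ler_pdivrMr ?normr_gt0//; apply: maxE => i.
  have [->|ik] := eqVneq i k.
    rewrite (_ : v0 + _ = x)//; apply/rowP => j; rewrite !mxE eqxx; ring.
  rewrite (_ : row _ _ = row i E)//; apply/rowP => j.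
  by rewrite !mxE (negbTE ik).
have phi_norm k : eta * eucl_norm (phi k) <= 4.
  apply: (width_le _ (dot (phi k) v0 - 2)) => // x /(phiA k).
  by rewrite dotBr ler_norml => /andP[]; lra.
have nR : (0 : R) < n%:R by rewrite ltr0n.
have n1R : (0 : R) < n.+1%:R by rewrite ltr0n.
have decomp x : x = \sum_k dot (phi k) x *: row k E.
  have -> : \sum_k dot (phi k) x *: row k E = (\row_k dot (phi k) x) *m E.
    by rewrite mulmx_sum_row; apply: eq_bigr => k _; rewrite mxE.
  have -> : \row_k dot (phi k) x = x *m invmx E.
    apply/rowP => k; rewrite !mxE /dot; apply: eq_bigr => j _.
    by rewrite /invmx unitmxE unitfE dE !mxE; ring.
  by rewrite mulmxKV// unitmxE unitfE.
pose a0 : R := n.+1%:R^-1.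
have comb (zeta : 'I_n -> R) : (forall k, `|zeta k| <= a0 / n.+1%:R) ->
    A (v0 + \sum_k (a0 + zeta k) *: row k E).
  move=> zetaP.
  have zeta_sum : `|\sum_k zeta k| <= a0.
    apply: le_trans (ler_norm_sum _ _ _) _.
    apply: (@le_trans _ _ (\sum_(k < n) a0 / n.+1%:R)); first exact: ler_sum.
    rewrite sumr_const card_ord -[_ *+ n]mulr_natr -mulrA ler_piMr ?invr_ge0 ?ltW//.
    by rewrite mulrC ltr_pdivrMr// mul1r ltr_nat.
  pose p (i : 'I_n.+1) := if unlift ord0 i is Some k then v0 + row k E else v0.
  pose a (i : 'I_n.+1) := if unlift ord0 i is Some k then a0 + zeta k
                          else 1 - \sum_k (a0 + zeta k).
  have sum_a : \sum_k (a0 + zeta k) = n%:R * a0 + \sum_k zeta k.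
    by rewrite big_split /= sumr_const card_ord -[_ *+ n]mulr_natl.
  have na0 : n%:R * a0 + a0 = 1.
    by rewrite -[X in _ + X]mul1r -mulrDl natr1 mulfV// gt_eqF.
  have aE0 : a ord0 = 1 - \sum_k (a0 + zeta k) by rewrite /a unlift_none.
  have pE0 : p ord0 = v0 by rewrite /p unlift_none.
  have := @convex_sum _ _ A cvxA _ a p; rewrite !big_ord_recl aE0 pE0.
  have aE k : a (lift ord0 k) = a0 + zeta k by rewrite /a liftK.
  have pE k : p (lift ord0 k) = v0 + row k E by rewrite /p liftK.
  rewrite (eq_bigr _ (fun k _ => aE k)) subrK.
  have -> : \sum_(i < n) a (lift ord0 i) *: p (lift ord0 i) =
      (\sum_k (a0 + zeta k)) *: v0 + \sum_k (a0 + zeta k) *: row k E.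
    rewrite scaler_suml -big_split /=; apply: eq_bigr => k _.
    by rewrite aE pE scalerDr.
  rewrite addrA -scalerDl subrK scale1r; apply=> // i.
  - rewrite /a; case: unliftP => [k _|_].
      have := zetaP k; rewrite ler_norml => /andP[zk _].
      rewrite -lerBlDl sub0r; apply: le_trans zk; rewrite lerN2.
      by rewrite ler_pdivrMr// ler_peMr ?ler1n// invr_ge0 ltW.
    rewrite sum_a; have := ler_norm (\sum_k zeta k); lra.
  - by rewrite /p; case: unliftP.
exists (v0 + \sum_k a0 *: row k E).
  have := comb (fun=> 0).
  rewrite (eq_bigr (fun k => a0 *: row k E)) => [|k _]; last by rewrite addr0.
  by apply=> k; rewrite normr0 divr_ge0 ?invr_ge0 ?ltW.
move=> z zP.
have := comb (fun k => dot (phi k) z).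
rewrite (eq_bigr (fun k => a0 *: row k E + dot (phi k) z *: row k E)) => [|k _]; last first.
  by rewrite scalerDl.
rewrite big_split /= -decomp addrA; apply=> k.
apply: le_trans (ler_norm_sum _ _ _) _.
set q := eta / _ in zP.
apply: (@le_trans _ _ (\sum_(i < n) eucl_norm (phi k) * q)).
  by apply: ler_sum => i _; rewrite normrM ler_pM ?coord_le_norm.
rewrite sumr_const card_ord -[_ *+ n]mulr_natr /q /a0.
rewrite (_ : _ * _ = (eta * eucl_norm (phi k) / 4) * (n.+1%:R^-1 / n.+1%:R)); last first.
  by field; rewrite !gt_eqF.
by rewrite ler_piMl ?divr_ge0 ?invr_ge0 ?(ltW n1R)// ler_pdivrMr// mul1r.
Qed.

End Inball.

(* d is a size of A up to constants; every point of A has, at each scale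
   sigma <= d, a nearby point of A in the lattice of mesh c * sigma. *)
Definition fat {R : realType} {n : nat} (c : R) (A : set 'rV[R]_n) (d : R) :=
  [/\ 0 < d, A !=set0, forall x y i, A x -> A y -> `|x 0 i - y 0 i| <= d &
    forall x sigma, A x -> 0 < sigma <= d -> exists2 k : 'I_n -> int,
      A (\row_i (c * sigma * (k i)%:~R)) &
      forall i, `|c * sigma * (k i)%:~R - x 0 i| <= 2 * sigma].

Lemma compact_coord_bounded {R : realType} {n : nat} (A : set 'rV[R]_n) :
  compact A -> exists M, forall x i, A x -> `|x 0 i| <= M.
Proof.
move=> /compact_bounded [M [_ MP]]; exists (M + 1) => x i Ax.
have := MP (M + 1); rewrite ltrDl ltr01 => /(_ isT x Ax) /= xM.
by apply: le_trans xM; rewrite /Num.norm /= mx_normrE;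
  apply: (le_bigmax _ (fun ij => `|x ij.1 ij.2|) (0, i)).
Qed.

(** [eta] is the height. A coordinate direction shows that it is finite, and that the empty set has
    height 0 and is excluded. *)
Lemma bounded_aspect_width {R : realType} {n : nat} (alpha : R) (A : set 'rV[R]_n) :
  (0 < n)%N -> compact A -> (aspect_ratio A <= alpha%:E)%E ->
  exists eta, [/\ 0 < eta, A !=set0,
    forall x y, A x -> A y -> eucl_norm (x - y) <= alpha * eta &
    forall u c h, eucl_norm u = 1 -> 0 <= h ->
      (forall x, A x -> c <= dot u x <= c + h) -> eta <= h].
Proof.
move=> n0 /compact_coord_bounded[M AM]; rewrite /aspect_ratio.
case: ifPn => [_|h0 asp]; first by rewrite leye_eq.
have width u c h : eucl_norm u = 1 -> 0 <= h ->
    (forall x, A x -> c <= dot u x <= c + h) -> (height A <= h%:E)%E.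
  by move=> u1 hh uA; apply: ereal_inf_lbound; exists h => //; split=> //; exists u, c.
have h_ge0 : (0 <= height A)%E by apply: le_ereal_inf_tmp => _ [h [h00 _] <-]; rewrite lee_fin.
pose e : 'rV[R]_n := delta_mx 0 (Ordinal n0).
have dote x : dot e x = x 0 (Ordinal n0).
  rewrite /dot (bigD1 (Ordinal n0))//= mxE !eqxx mul1r big1 ?addr0// => i /negbTE i0.
  by rewrite mxE i0 andbF mul0r.
have e1 : eucl_norm e = 1 by rewrite /eucl_norm dote mxE !eqxx sqrtr1.
have A0 : A !=set0.
  apply: contrapT => nA; move/eqP: h0; apply; apply/eqP; rewrite eq_le h_ge0 andbT.
  by apply: (width e 0 0) => // x Ax; case: nA; exists x.
have M0 : 0 <= M by case: A0 => x Ax; apply: le_trans (AM _ (Ordinal n0) Ax).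
have h_fin : (height A < +oo)%E.
  apply: (@le_lt_trans _ _ (2 * M)%:E); last exact: ltry.
  apply: (width e (- M)) => //; first by lra.
  by move=> x Ax; rewrite dote; have := AM _ (Ordinal n0) Ax; rewrite ler_norml; lra.
have hE : height A = (fine (height A))%:E by rewrite fineK// ge0_fin_numE.
have eta0 : 0 < fine (height A).
  by rewrite -lte_fin -hE lt_def h0.
exists (fine (height A)); split=> //.
- move=> x y Ax Ay; move: asp; rewrite hE inver gt_eqF// lee_pdivrMr// => asp.
  rewrite -lee_fin EFinM; apply: le_trans asp.
  by apply: ereal_sup_ubound; exists x, y; split.
- by move=> u c h u1 hh uA; rewrite -lee_fin -hE; exact: width u1 hh uA.
Qed.

(** Contract [A] towards [x] by the ratio [t = sigma / d]. The inscribed cube becomes one of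
    half-side [cc * sigma] around [g'], which is within [sigma] of [x]; rounding [g'] to the lattice
    stays in this cube. *)
Lemma bounded_aspect_fat {R : realType} {n : nat} (alpha : R) (A : set 'rV[R]_n) :
  (0 < n)%N -> 1 <= alpha -> compact A -> convex_set A ->
  (aspect_ratio A <= alpha%:E)%E ->
  exists d, fat (alpha * (4 * n%:R * n.+1%:R ^+ 2))^-1 A d.
Proof.
move=> n0 alpha1 cA cvxA /(bounded_aspect_width _ _ n0 cA)[eta [eta0 [v0 Av0] diamA widthA]].
have [M AM] := compact_coord_bounded A cA.
have [g Ag ball_g] := inball A v0 M eta cvxA Av0 AM eta0 widthA n0.
set q := 4 * _ * _ in ball_g *.
have q1 : 1 <= q.
  have nR : (1 : R) <= n%:R by rewrite ler1n.
  have n1R : (1 : R) <= n.+1%:R by rewrite ler1n.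
  rewrite /q -[X in X <= _]mul1r ler_pM// ?exprn_ege1//.
  by rewrite -[X in X <= _]mul1r ler_pM//; lra.
have coordA x y i : A x -> A y -> `|x 0 i - y 0 i| <= alpha * eta.
  move=> Ax Ay; apply: le_trans (diamA x y Ax Ay).
  by have := coord_le_norm (x - y) i; rewrite !mxE.
have al0 : 0 < alpha by lra.
have q0 : 0 < q by lra.
exists (alpha * eta); split=> //; [by rewrite mulr_gt0|by exists v0|].
move=> x sigma Ax /andP[s0 sd].
set d := alpha * eta in sd *; have d0 : 0 < d by rewrite mulr_gt0.
set cc := (alpha * q)^-1.
have cc0 : 0 < cc by rewrite invr_gt0 mulr_gt0.
have cc1 : cc <= 1.
  have aq1 : 1 <= alpha * q by apply: (le_trans alpha1); rewrite ler_peMr // ltW.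
  by rewrite /cc invf_le1 // mulr_gt0.
have cs0 : 0 < cc * sigma by rewrite mulr_gt0.
pose t := sigma / d.
have t0 : 0 < t by rewrite divr_gt0.
have t1 : t <= 1 by rewrite ler_pdivrMr// mul1r.
pose g' i := t * g 0 i + (1 - t) * x 0 i.
pose k i := Num.floor (g' i / (cc * sigma)).
have kP i : `|cc * sigma * (k i)%:~R - g' i| <= cc * sigma.
  have /andP[] := floor_itv (g' i / (cc * sigma)).
  rewrite ler_pdivlMr// ltr_pdivrMr// -/(k i) rmorphD /= mulrDl mul1r => k1 k2.
  by rewrite ler_norml; apply/andP; split; lra.
exists k.
  set y := \row_i _.
  pose z : 'rV[R]_n := \row_i ((cc * sigma * (k i)%:~R - g' i) / t).
  have Agz : A (g + z).
    apply: ball_g => i; rewrite mxE normrM normfV (gtr0_norm t0) ler_pdivrMr//.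
    rewrite (_ : _ * t = cc * sigma) ?kP// /t /cc /d; field.
    by rewrite !gt_eqF.
  rewrite (_ : y = t *: (g + z) + (1 - t) *: x).
    by apply: convex_comb => //; rewrite (ltW t0).
  apply/rowP => i; rewrite !mxE /g'; field.
  by rewrite gt_eqF.
move=> i; have := kP i; have gx : `|g' i - x 0 i| <= sigma.
  rewrite (_ : g' i - x 0 i = t * (g 0 i - x 0 i)); last by rewrite /g'; ring.
  rewrite normrM (gtr0_norm t0) /t -mulrAC ler_pdivrMr// ler_pM2l//.
  exact: coordA.
have ccs : cc * sigma <= sigma by rewrite ler_piMl// ltW.
rewrite !ler_norml in gx *; lra.
Qed.

(** * Walks as graded distances *)

Fixpoint walk {X : Type} (E : X -> X -> Prop) (k : nat) (x y : X) : Prop :=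
  if k is k'.+1 then exists2 z, E x z & walk E k' z y else x = y.

Lemma walk_imp {X : Type} {E E' : X -> X -> Prop} k x y :
  (forall x y, E x y -> E' x y) -> walk E k x y -> walk E' k x y.
Proof. by move=> EE'; elim: k x => //= k IH x [z /EE' xz /IH zy]; exists z. Qed.

Section Walk.
Context {X : Type}.
Variable E : X -> X -> Prop.
Hypotheses (Er : forall x, E x x) (Es : forall x y, E x y -> E y x).

Lemma walk_trans k l x y z : walk E k x y -> walk E l y z -> walk E (k + l) x z.
Proof. by elim: k x => [|k IH] x /= => [->//|[t xt ty] yz]; exists t => //; exact: IH. Qed.

Lemma walk_graded : graded (walk E).
Proof.
split=> //; last 1 first.
- move=> k l x y /subnKC <- xy; apply: walk_trans xy _.
  by elim: (l - k)%N => //= m IH; exists y.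
- elim=> [|k IH] x y /= => [->//|[z xz /IH zy]].
  suff : walk E (k + 1) y x by rewrite addn1.
  by apply: walk_trans zy _; exists x => //; exact: Es.
- exact: walk_trans.
Qed.

Lemma walk_scale {nd : nat -> X -> X -> Prop} m k x y : graded nd ->
  (forall x y, E x y -> nd m x y) -> walk E k x y -> nd (k * m)%N x y.
Proof.
move=> gnd Em; elim: k x => [|k IH] x /= => [->|[z /Em xz /IH zy]].
  exact: nd_refl.
by rewrite mulSn; apply: (nd_trans _ gnd) xz zy.
Qed.

End Walk.

(** * Nested shifted grids *)

Section ShiftedGrids.
Context {R : realType}.

(* Grids of mesh (n+1) * l and (n+1) * K * l, shifted by j * l and j * K * l, are
   nested because K = n + 2 is 1 modulo n + 1; see [cell_nest]. *)
Lemma floor_div_congr (u v : R) (j K : nat) : (0 < K)%N ->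
  Num.floor u = Num.floor v ->
  Num.floor ((u - j%:R) / K%:R) = Num.floor ((v - j%:R) / K%:R).
Proof.
move=> K0 uv.
have KR : (0 : R) < K%:R by rewrite ltr0n.
have main (x y : R) : Num.floor x = Num.floor y ->
    Num.floor ((x - j%:R) / K%:R) <= Num.floor ((y - j%:R) / K%:R).
  move=> xy; rewrite floor_ge_int ler_pdivlMr//.
  set q := Num.floor _.
  have : (q * K%:Z + j%:Z <= Num.floor x).
    rewrite floor_ge_int rmorphD rmorphM /=.
    have := floor_le ((x - j%:R) / K%:R); rewrite -/q ler_pdivlMr//.
    rewrite -[j%:R]/(j%:~R) -[K%:R]/(K%:~R); lra.
  rewrite xy floor_ge_int rmorphD rmorphM /= -[j%:R]/(j%:~R) -[K%:R]/(K%:~R); lra.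
by apply/eqP; rewrite eq_le !main.
Qed.

(* Each coordinate is within 1/2 of a wall for at most one of the n + 1 shifts. *)
Lemma deep_shift n (y : 'I_n -> R) : exists j : 'I_n.+1, forall k y',
  `|y' - y k| < 1 / 2 ->
  Num.floor ((y' - j%:R) / n.+1%:R) = Num.floor ((y k - j%:R) / n.+1%:R).
Proof.
pose b k : 'I_n.+1 := inord `|(Num.floor (y k + 1 / 2) %% n.+1%:Z)%Z|%N.
have [j jb] : exists j, j \notin codom b.
  apply: contrapT => nj.
  have : (#|'I_n.+1| <= #|codom b|)%N.
    by apply/subset_leq_card/fintype.subsetP => j _; apply/negPn/negP => jb; apply: nj; exists j.
  rewrite card_ord => /leq_trans /(_ (card_size _)); rewrite size_codom card_ord.
  by rewrite ltnn.
exists j => k y' yy'.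
have nR : (0 : R) < n.+1%:R by rewrite ltr0n.
set q := Num.floor ((y k - j%:R) / n.+1%:R).
have nE : forall m : int, Num.floor (y k + 1 / 2) <> m * n.+1%:Z + j%:Z.
  move=> m fE; move/negP: jb; apply; apply/codomP; exists k.
  rewrite /b fE; apply/val_inj => /=.
  rewrite modzMDl modz_small; last by have := ltn_ord j; lia.
  by rewrite inordK absz_nat //; exact: ltn_ord.
have /andP[] := floor_itv ((y k - j%:R) / n.+1%:R); rewrite -/q.
rewrite ler_pdivlMr// ltr_pdivrMr// => q1 q2.
have q1' : q%:~R * n.+1%:R + 1 / 2 <= y k - j%:R.
  rewrite leNgt; apply/negP => lt1; apply: (nE q); apply: floor_def.
  rewrite !rmorphD !rmorphM /= -[j%:~R]/(j%:R) -[n.+1%:~R]/(n.+1%:R); apply/andP; split; lra.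
have q2' : y k - j%:R < (q + 1)%:~R * n.+1%:R - 1 / 2.
  rewrite ltNge; apply/negP => lt1; apply: (nE (q + 1)); apply: floor_def.
  rewrite !rmorphD !rmorphM /= -[j%:~R]/(j%:R) -[n.+1%:~R]/(n.+1%:R).
  rewrite !rmorphD /= in q2 lt1; apply/andP; split; lra.
apply: floor_def; rewrite ler_pdivlMr// ltr_pdivrMr//.
move: yy'; rewrite ltr_norml => /andP[]; set a := q%:~R * _ in q1 q1' *.
set a' := (q + 1)%:~R * _ in q2 q2' *.
by move=> *; apply/andP; split; lra.
Qed.

End ShiftedGrids.

(** * Colouring fat sets whose sizes span finitely many scales *)

Section FatSystem.
Context {R : realType} {n : nat} {I : Type}.
Variables (c : R) (pts : I -> set 'rV[R]_n) (d : I -> R).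
Hypotheses (c0 : 0 < c) (fatI : forall A, fat c (pts A) (d A)).

Definition touching (P : I -> Prop) A B :=
  A = B \/ [/\ P A, P B & pts A `&` pts B !=set0].

Lemma touching_refl P A : touching P A A. Proof. by left. Qed.

Lemma touching_sym P A B : touching P A B -> touching P B A.
Proof. by move=> [->|[PA PB AB]]; [left|right; rewrite setIC]. Qed.

Lemma touching_walk_graded P : graded (walk (touching P)).
Proof. exact: walk_graded (touching_refl P) (@touching_sym P). Qed.

Lemma walk_closed (P : I -> Prop) k A B : walk (touching P) k A B -> P A -> P B.
Proof.
elim: k A => [|k IH] A /= => [->|[Z [->|[_ PZ _]] ZB] PA] //; first exact: IH ZB PA.
exact: IH ZB PZ.
Qed.

Lemma touching_point P A Z a : touching P A Z -> pts A a ->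
  exists2 z, pts Z z & forall i, `|z 0 i - a 0 i| <= d A.
Proof.
move=> AZ Aa; have [dA _ diamA _] := fatI A.
case: AZ => [<-|[_ _ [z [Az Zz]]]]; [exists a => //|exists z => //] => i; exact: diamA.
Qed.

Lemma walk_dist P s k A B a b : walk (touching P) k A B -> 0 < s ->
  (forall m C, (m <= k)%N -> walk (touching P) m A C -> d C < s) ->
  pts A a -> pts B b -> forall i, `|b 0 i - a 0 i| < k.+1%:R * s.
Proof.
move=> + s0; elim: k A a => [|k IH] A a /= => [->|[Z AZ ZB]] small Aa Bb i.
  have [_ _ diamB _] := fatI B.
  by rewrite mul1r; apply: le_lt_trans (small 0%N B _ _) => //; exact: diamB.
have [z Zz za] := touching_point _ _ _ _ AZ Aa.
have smallZ m C : (m <= k)%N -> walk (touching P) m Z C -> d C < s.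
  by move=> mk ZC; apply: (small m.+1) => //; exists Z.
have := IH Z z ZB smallZ Zz Bb i; have := za i; have := small 0%N A isT erefl.
rewrite -[k.+2%:R]natr1 mulrDl mul1r !ltr_norml ler_norml.
set t := k.+1%:R * s; lra.
Qed.

(** Stop at the first set of size at least [s]: the sets before it are smaller, so each step moves
    by at most [s]. *)
Lemma walk_first_large P s k A B a : 0 < s -> walk (touching P) k A B -> s <= d B -> pts A a ->
  exists C y, [/\ walk (touching P) k A C, s <= d C, pts C y &
    forall i, `|y 0 i - a 0 i| <= k%:R * s].
Proof.
have gnd := touching_walk_graded P.
move=> s0 + sB; elim: k A a => [|k IH] A a.
  move=> /= -> Ba; exists B, a; split=> // i; by rewrite subrr normr0 mul0r.
move=> [Z AZ ZB] Aa; have [sA|As] := leP s (d A).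
  exists A, a; split=> //; first by apply: (nd_mono _ gnd 0) => //.
  by move=> i; rewrite subrr normr0 mulr_ge0// ltW.
have [z Zz za] := touching_point _ _ _ _ AZ Aa.
have [C [y [ZC sC Cy ys]]] := IH Z z ZB Zz.
exists C, y; split=> //; first by exists Z.
move=> i; rewrite -natr1 mulrDl mul1r; have := ys i; have := za i.
rewrite !ler_norml; lra.
Qed.


Section Coloring.
Variables (lambda : R) (h r : nat).
Hypothesis lambda0 : 0 < lambda.

Let K : R := n.+2%:R.
Let sigma i : R := lambda * K ^+ i.
Let P A := lambda <= d A < sigma h.
Let nd := walk (touching P).
Let gnd : graded nd := touching_walk_graded P.
(** If no set within distance [r] of [A] has size [sigma i.+1] or more, these sets reach less than
    [r.+1%:R * sigma i.+1] from the centre of [A]: half a [step i], the margin [1 / 2] of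
    [deep_shift]. *)
Let step i : R := 2 * r.+1%:R * sigma i.+1.

Let K1 : 1 <= K. Proof. by rewrite ler1n. Qed.
Let K0 : 0 < K. Proof. by rewrite ltr0n. Qed.
Let sigma0 i : 0 < sigma i. Proof. by rewrite mulr_gt0// exprn_gt0. Qed.
Let step0 i : 0 < step i. Proof. by rewrite mulr_gt0// mulr_gt0// ltr0n. Qed.

Let sigma_mono i j : (i <= j)%N -> sigma i <= sigma j.
Proof. by move=> ij; rewrite ler_pM2l// ler_weXn2l. Qed.

Definition level_of (lo : I -> nat) := forall A, P A ->
  [/\ (lo A < h)%N, exists2 B, nd r A B & P B /\ sigma (lo A) <= d B &
    forall B, nd r A B -> d B < sigma (lo A).+1].

Lemma level_exists : exists lo, level_of lo.
Proof.
suff /choice[lo loP] : forall A, exists l, P A ->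
    [/\ (l < h)%N, exists2 B, nd r A B & P B /\ sigma l <= d B &
    forall B, nd r A B -> d B < sigma l.+1] by exists lo.
move=> A.
have [PA|nPA] := EM (P A); last by exists 0%N.
pose Q i := `[< exists2 B, nd r A B & P B /\ sigma i <= d B >].
have exQ : exists i, Q i.
  exists 0%N; apply/asboolP; exists A; first exact: (nd_mono _ gnd 0 r).
  by split=> //; rewrite /sigma expr0 mulr1; case/andP: PA.
have Qh i : Q i -> (i <= h)%N.
  move=> /asboolP[B _ [/andP[_ Bh] iB]]; rewrite leqNgt; apply/negP => hi.
  by have := sigma_mono _ _ (ltnW hi); rewrite leNgt (le_lt_trans iB).
have [i /asboolP[B AB [PB iB]] imax] := ex_maxnP exQ Qh.
exists i => _; split; last first.
- move=> C wC; rewrite ltNge; apply/negP => iC.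
  suff /imax : Q i.+1 by rewrite ltnn.
  by apply/asboolP; exists C => //; split=> //; exact: walk_closed wC PA.
- by exists B.
- rewrite ltnNge; apply/negP => hi; have := sigma_mono _ _ hi.
  by case/andP: (PB) => _ Bh; rewrite leNgt (le_lt_trans iB).
Qed.

Lemma center_exists : exists p : I -> 'rV[R]_n, forall A, pts A (p A).
Proof.
suff /choice[p pP] : forall A, exists a, pts A a by exists p.
by move=> A; have [_ [a Aa] _ _] := fatI A; exists a.
Qed.

Variables (lo : I -> nat) (p : I -> 'rV[R]_n).
Hypotheses (loP : level_of lo) (pP : forall A, pts A (p A)).

(* The cell, in the j-th grid of scale i, of the centre of A. *)
Definition cell (j i : nat) (A : I) : 'I_n -> int :=
  fun k => Num.floor ((p A 0 k / step i - j%:R) / n.+1%:R).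

Lemma cell_nest j i k A B : (i <= k)%N -> cell j i A = cell j i B ->
  cell j k A = cell j k B.
Proof.
move=> /subnKC <-; elim: (k - i)%N => [|m IH] AB; first by rewrite addn0.
rewrite addnS; have {}IH := IH AB; set l := (i + m)%N in IH *.
(* The identity [j / n.+1 = (j / n.+1 + j) / n.+2] brings the coarser coordinate to the form of
   [floor_div_congr]. *)
have K_step D : forall k, (p D 0 k / step l.+1 - j%:R) / n.+1%:R =
    ((p D 0 k / step l - j%:R) / n.+1%:R - j%:R) / n.+2%:R.
  move=> t; rewrite /step /sigma [K ^+ l.+2]exprS.
  have : lambda != 0 by rewrite gt_eqF.
  have : K ^+ l.+1 != 0 by rewrite gt_eqF// exprn_gt0.
  rewrite /K; set e := _ ^+ _; move=> e0 l0; field.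
  rewrite e0 l0 /=; apply/and3P; split; by rewrite ?pnatr_eq0 -?natrD ?pnatr_eq0 // gt_eqF // ltr0n.
apply/funext => t; rewrite /cell !K_step; apply: floor_div_congr => //.
exact: (congr1 (@^~ t) IH).
Qed.

Lemma shift_exists : exists js : I -> 'I_n.+1, forall A B i, P A -> nd r A B ->
  (lo A <= i)%N -> cell (js A) i A = cell (js A) i B.
Proof.
have /choice[js jsP] := fun A => deep_shift n (fun k => p A 0 k / step (lo A)).
exists js => A B i PA AB Ai; apply: cell_nest Ai _; apply/funext => k; apply/esym.
apply: jsP; have [_ _ small] := loP A PA.
have smallA m C : (m <= r)%N -> walk (touching P) m A C -> d C < sigma (lo A).+1.
  by move=> mr wC; apply: small; exact: (nd_mono _ gnd _ _ _ _ mr wC).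
have := walk_dist _ _ _ _ _ _ _ AB (sigma0 (lo A).+1) smallA (pP A) (pP B) k.
rewrite -mulrBl normrM normfV (gtr0_norm (step0 _)) ltr_pdivrMr// => /lt_le_trans; apply.
by rewrite /step; lra.
Qed.

Variable js : I -> 'I_n.+1.
Hypothesis jsP : forall A B i, P A -> nd r A B -> (lo A <= i)%N ->
  cell (js A) i A = cell (js A) i B.

Section Color.
Variable j : 'I_n.+1.

Let Y A := P A /\ js A = j.

(** Chosen so that two sets of shift [j] at distance at most [r] share a bag at the larger of their
    levels; see [near_shared_bag]. *)
Definition top_level_of (hi : I -> nat) := forall A, Y A ->
  (exists2 B, nd r A B & Y B /\ lo B = hi A) /\
  (forall B, nd r A B -> Y B -> (lo B <= hi A)%N).

Lemma top_level_exists : exists hi, top_level_of hi.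
Proof.
suff /choice[hi hiP] : forall A, exists l, Y A ->
    (exists2 B, nd r A B & Y B /\ lo B = l) /\
    (forall B, nd r A B -> Y B -> (lo B <= l)%N) by exists hi.
move=> A; have [YA|nYA] := EM (Y A); last by exists 0%N.
pose Q i := `[< exists2 B, nd r A B & Y B /\ lo B = i >].
have exQ : exists i, Q i.
  by exists (lo A); apply/asboolP; exists A => //; exact: (nd_mono _ gnd 0 r).
have Qh i : Q i -> (i <= h)%N.
  by move=> /asboolP[B _ [[PB _] <-]]; have [/ltnW] := loP B PB.
have [i /asboolP Qi imax] := ex_maxnP exQ Qh.
exists i => _; split=> // B AB YB; apply: imax.
by apply/asboolP; exists B.
Qed.

Variable hi : I -> nat.
Hypothesis hiP : top_level_of hi.

Let bag i A := Y A /\ (lo A <= i <= hi A)%N.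

(** The graph that is decomposed. It joins all pairs of [Y] at distance at most [r], and [4 * r + 1]
    is the distance reached in [bag_labelled]. *)
Definition shared_bag A B := A = B \/
  exists i, [/\ bag i A, bag i B, cell j i A = cell j i B & nd (4 * r + 1) A B].

Let ndH := walk shared_bag.

Lemma shared_bag_graded : graded ndH.
Proof.
apply: walk_graded => [A|A B [->|[i [bA bB AB wAB]]]]; [by left|by left|right].
by exists i; split=> //; exact: (nd_sym _ gnd).
Qed.

Lemma shared_bag_walk k A B : ndH k A B -> nd (k * (4 * r + 1)) A B.
Proof.
apply: walk_scale gnd _ => x y [->|[i []//]].
by apply: (nd_mono _ gnd 0) => //; exact: (nd_refl _ gnd).
Qed.

Lemma near_shared_bag A B : Y A -> Y B -> nd r A B -> ndH 1 A B.
Proof.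
move=> YA YB AB; exists B => //; right.
have wAB : nd (4 * r + 1) A B by apply: (nd_mono _ gnd) AB; lia.
have wBA := nd_sym _ gnd _ _ _ AB.
have self C : Y C -> (lo C <= hi C)%N.
  by move=> YC; apply: (hiP C YC).2 => //; exact: (nd_mono _ gnd 0 r).
have [le_AB|/ltnW le_BA] := leqP (lo A) (lo B).
  exists (lo B); split=> //.
  - by split=> //; rewrite le_AB; exact: (hiP A YA).2.
  - by split=> //; rewrite leqnn self.
  - by case: YA => PA <-; exact: jsP.
exists (lo A); split=> //.
- by split=> //; rewrite leqnn self.
- by split=> //; rewrite le_BA; exact: (hiP B YB).2.
- by case: YB => PB <-; apply/esym/jsP.
Qed.

(* Bounds the number of lattice steps, in each coordinate, across the relevant
   neighbourhood of a cell. *)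
Definition box_size : nat :=
  (Num.trunc ((2 * r.+1%:R * K * n.+1%:R + 2 * r.+2%:R) / c)).+1.

Lemma bag_lattice_point i A : bag i A -> exists k : 'I_n -> int,
  (exists2 B, nd (2 * r) A B & pts B (\row_t (c * sigma i * (k t)%:~R))) /\
  forall t, 0 <= k t - Num.floor
    ((2 * r.+1%:R * K * (cell j i A t * n.+1%:Z + j%:Z)%:~R - r.+2%:R) / c)
    <= box_size%:Z.
Proof.
move=> [YA /andP[Ai iA]].
have [[A' AA' [YA' loA']] _] := hiP A YA.
have [_ [M A'M [PM dM]] _] := loP A' YA'.1.
have iM : sigma i <= d M by apply: le_trans dM; apply: sigma_mono; rewrite loA'.
have [C [y [A'C iC Cy ya]]] := walk_first_large _ _ _ _ _ _ (sigma0 i) A'M iM (pP A').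
have [_ _ _ latC] := fatI C.
have [|k Ck ky] := latC y (sigma i) Cy; first by rewrite sigma0.
exists k; split.
  by exists C => //; rewrite mul2n -addnn; exact: (nd_trans _ gnd) AA' A'C.
move=> t; have -> : cell j i A = cell j i A' by case: YA => PA <-; exact: jsP.
have := floor_itv ((p A' 0 t / step i - j%:R) / n.+1%:R).
rewrite -/(cell j i A' t); set g := cell j i A' t.
have nR : (0 : R) < n.+1%:R by rewrite ltr0n.
rewrite ler_pdivlMr// ltr_pdivrMr// lerBrDr ltrBlDr ler_pdivlMr// ltr_pdivrMr//.
set q : R := (_ * _ + _)%:~R.
have qE : q = g%:~R * n.+1%:R + j%:R by rewrite /q rmorphD rmorphM.
have qE1 : (g + 1)%:~R * n.+1%:R + j%:R = q + n.+1%:R by rewrite qE rmorphD /=; ring.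
rewrite -qE qE1 => /andP[q1 q2].
have stepE : step i = 2 * r.+1%:R * K * sigma i.
  by rewrite /step /sigma exprS; ring.
set Q := 2 * r.+1%:R * K in stepE *.
have q1' : (Q * q) * sigma i <= p A' 0 t by move: q1; rewrite stepE; lra.
have q2' : p A' 0 t < (Q * q + Q * n.+1%:R) * sigma i.
  by move: q2; rewrite stepE; lra.
have {}ya := ya t; have {}ky := ky t.
rewrite !ler_norml in ya ky.
have r2E : r.+2%:R * sigma i = r%:R * sigma i + 2 * sigma i.
  by rewrite -mulrDl -[2 in RHS]/(2%:R) -natrD addn2.
have k1 : Q * q - r.+2%:R <= c * (k t)%:~R.
  rewrite -(ler_pM2r (sigma0 i)) mulrBl r2E; lra.
have k2 : c * (k t)%:~R < Q * q + Q * n.+1%:R + r.+2%:R.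
  rewrite -(ltr_pM2r (sigma0 i)) [X in _ < X]mulrDl r2E; lra.
set m := Num.floor _; have /andP[] := floor_itv ((Q * q - r.+2%:R) / c).
rewrite -/m ler_pdivlMr// ltr_pdivrMr// => m1 m2.
have kR : (m%:~R : R) <= (k t)%:~R by rewrite -(ler_pM2r c0); lra.
rewrite subr_ge0 -(ler_int R) kR /= /box_size.
set X := (_ + _) / c.
have X0 : 0 <= X.
  by rewrite /X /Q !(mulr_ge0, addr_ge0, invr_ge0)// ltW.
have /andP[_ XT] := truncn_itv X0.
have Xc : X * c = Q * n.+1%:R + 2 * r.+2%:R by rewrite /X mulfVK// gt_eqF.
have : ((k t)%:~R - m%:~R : R) < X + 1.
  rewrite rmorphD mulrDl mul1r in m2.
  rewrite -(ltr_pM2r c0) mulrBl mulrDl Xc mul1r; lra.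
set T := (Num.trunc X).+1 in XT *.
move=> kX; rewrite -ltzD1 -(ltr_int R) rmorphB rmorphD /= -[T%:~R]/(T%:R); lra.
Qed.

(** The label is the lattice point, relative to its box. Two sets of a bag with the same label are
    within [2 * r] of two sets that share this point, hence within [2 * r + 1 + 2 * r] of each
    other. *)
Lemma bag_labelled i g : labelled ndH 1 #|{ffun 'I_n -> 'I_box_size.+1}|
  (fun u => [/\ Y u, (lo u <= i <= hi u)%N & cell j i u = g]).
Proof.
pose m t := Num.floor ((2 * r.+1%:R * K * (g t * n.+1%:Z + j%:Z)%:~R - r.+2%:R) / c).
have /choice[k kP] : forall A, exists k : 'I_n -> int, bag i A -> cell j i A = g ->
    (exists2 B, nd (2 * r) A B & pts B (\row_t (c * sigma i * (k t)%:~R))) /\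
    forall t, 0 <= k t - m t <= box_size%:Z.
  move=> A; have [bA|nb] := EM (bag i A); last by exists (fun=> 0).
  by have [k kP] := bag_lattice_point i A bA; exists k => _ gE; rewrite /m -gE.
exists (fun A => nat_of_ord (enum_rank
  [ffun t => inord `|k A t - m t|%N : 'I_box_size.+1])); split=> //.
move=> u v [Yu ui gu] [Yv vi gv] /ord_inj/enum_rank_inj/ffunP kuv.
have [bu bv] : bag i u /\ bag i v by [].
have [[B uB Bk] ku] := kP u bu gu; have [[B' vB' Bk'] kv] := kP v bv gv.
have kE : k u = k v.
  apply/funext => t; have := kuv t; rewrite !ffunE => /(congr1 val) /=.
  have := ku t; have := kv t.
  move=> /andP[v0 v1] /andP[u0 u1].
  have bd (z : int) : 0 <= z -> z <= box_size%:Z -> (`|z| < box_size.+1)%N by lia.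
  rewrite !inordK ?bd// => uv.
  have eu := gez0_abs u0; rewrite uv (gez0_abs v0) in eu.
  exact: (addIr _ (esym eu)).
exists v => //; right; exists i; split=> //; first by rewrite gu gv.
have BB' : nd 1 B B'.
  exists B' => //; right; split; first exact: walk_closed uB Yu.1.
    exact: walk_closed vB' Yv.1.
  by exists (\row_t (c * sigma i * (k u t)%:~R)); split=> //; rewrite kE.
have := nd_trans _ gnd _ _ _ _ _ uB (nd_trans _ gnd _ _ _ _ _ BB' (nd_sym _ gnd _ _ _ vB')).
by apply: (nd_mono _ gnd); lia.
Qed.

Lemma color_tree_system : tree_system ndH #|{ffun 'I_n -> 'I_box_size.+1}|
  Y (fun=> False) lo hi (cell j).
Proof.
split.
- exact: shared_bag_graded.
- by move=> A YA; apply: (hiP A YA).2 => //; exact: (nd_mono _ gnd 0 r).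
- move=> i k A B; exact: cell_nest.
- move=> m i x y Yx Yy xy _ xi nyi.
  elim: m x Yx xy xi nyi => [|m IH] x Yx /= => [xy|[z xz zy]] xi nyi.
    by case: nyi; rewrite -xy.
  case: (xz) => [xzE|[k [[_ xk] [Yz zk] xzk _]]].
    rewrite -xzE in zy; have [a [p0 [q [Ya ai ca pq xay]]]] := IH x Yx zy xi nyi.
    by exists a, p0, q; split=> //; lia.
  have [[zi czi]|nz] := EM ((lo z <= i)%N /\ cell j i x = cell j i z).
    have [|a [p0 [q [Ya ai ca pq [za ay]]]]] := IH z Yz zy zi; first by rewrite -czi.
    exists a, p0.+1, q; split=> //; [by rewrite czi|split=> //].
    by exists z.
  (* If [z] leaves the cell or starts above [i], the level [k] of the bag shared with [x] exceeds
     [i], so [x] itself separates. *)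
  exists x, 0%N, m.+1; split=> //; last by split=> //; exists z.
  rewrite xi /=.
  have [ki|] := leqP k i; last by lia.
  case: nz; split; first by lia.
  exact: cell_nest xzk.
- exact: bag_labelled.
Qed.

End Color.

Lemma coloring_of_levels s D : two_colorable #|{ffun 'I_n -> 'I_box_size.+1}| 1 s D ->
  exists col : I -> 'I_n.+1 * bool, forall b x y,
    chain (fun A => P A /\ col A = b) (nd r) x y -> nd (D * (4 * r + 1)) x y.
Proof.
move=> colorable.
have /choice[chi chiP] : forall j, exists chi : I -> bool, forall b x y,
    chain (fun A => (P A /\ js A = j) /\ chi A = b) (nd r) x y -> nd (D * (4 * r + 1)) x y.
  move=> j; have [hi hiP] := top_level_exists j.
  have hih A : P A /\ js A = j -> (hi A < h)%N.
    move=> YA; have [[B _ [[PB _] <-]] _] := hiP A YA.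
    by have [] := loP B PB.
  have [chi chiP] := colorable _ _ _ _ _ _ _ _ _ (color_tree_system j hi hiP) hih.
  exists chi => b x y xy; apply: (shared_bag_walk j hi); apply: (chiP b).
  apply: chain_imp xy => [A [YA Ab]|A B [YA _] [YB _] AB].
    by split=> //; split=> // -[].
  exact: near_shared_bag.
exists (fun A => (js A, chi (js A) A)) => -[j b] x y xy; apply: (chiP j b).
by apply: chain_imp xy => // A [PA [jA <-]]; rewrite jA.
Qed.

End Coloring.

Lemma fat_coloring lambda h r s D : 0 < lambda ->
  two_colorable #|{ffun 'I_n -> 'I_(box_size r).+1}| 1 s D ->
  let P A := lambda <= d A < lambda * n.+2%:R ^+ h in
  exists col : I -> 'I_n.+1 * bool, forall b x y,
    chain (fun A => P A /\ col A = b) (walk (touching P) r) x y ->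
    walk (touching P) (D * (4 * r + 1)) x y.
Proof.
move=> l0 colorable P.
have [lo loP] := level_exists lambda h r l0.
have [p pP] := center_exists.
have [js jsP] := shift_exists lambda h r l0 lo p loP pP.
exact: (coloring_of_levels lambda h r l0 lo p loP pP js jsP s D).
Qed.

End FatSystem.

(** * From finitely many scales to all, along an ultrafilter *)

Lemma ultra_constant {T : Type} {J : finType} (F : set_system T) (f : T -> J) :
  UltraFilter F -> exists j, F [set t | f t = j].
Proof.
move=> UF; apply: contrapT => nj.
have [t] : exists t, forall j, f t <> j.
  apply: (filter_ex (F := F)); apply: filter_forall => j.
  by have [Fj|//] := in_ultra_setVsetC [set t | f t = j] UF; case: nj; exists j.
exact.
Qed.

Section Truncation.
Context {R : realType} {n : nat} {I : Type}.
Variables (c : R) (pts : I -> set 'rV[R]_n) (d : I -> R).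
Hypotheses (c0 : 0 < c) (fatI : forall A, fat c (pts A) (d A)).

Let K : R := n.+2%:R.
Let P N A := K ^- N <= d A < K ^- N * K ^+ (2 * N).

Lemma scale_range_eventually A : \forall N \near \oo, P N A.
Proof.
have [dA _ _ _] := fatI A.
have K0 N : 0 < K ^+ N by rewrite exprn_gt0// ltr0n.
have K_large (x : R) : \forall N \near \oo, x < K ^+ N.
  near=> N; apply: (@lt_trans _ _ N%:R); first by near: N; exact: nbhs_infty_gtr.
  by rewrite /K -natrX ltr_nat ltn_expl.
near=> N; apply/andP; split.
  rewrite -[K ^- N]mul1r ler_pdivrMr// mulrC -ler_pdivrMr// mul1r ltW//.
  by near: N; exact: K_large.
rewrite mul2n -addnn exprD mulrA mulVf ?mul1r ?gt_eqF//.
by near: N; exact: K_large.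
Unshelve. all: by end_near.
Qed.

Lemma walk_eventually k A B : walk (touching pts (fun=> True)) k A B ->
  \forall N \near \oo, walk (touching pts (P N)) k A B.
Proof.
elim: k A => [|k IH] A /=; first by move=> ->; near=> N.
move=> [Z AZ /IH ZB]; case: AZ => [->|[_ _ AZ]].
  by near=> N; exists Z; [left|near: N].
have PA := scale_range_eventually A; have PZ := scale_range_eventually Z.
by near=> N; exists Z; [right; split=> //; near: N|near: N].
Unshelve. all: by end_near.
Qed.

(** A chain is finite, so for [U]-many [N] it lies within the range [P N] and its limit colours
    agree with [colN N]. One such [N] suffices, because the bound does not depend on [N]. *)
Lemma untruncated_coloring r s D :
  two_colorable #|{ffun 'I_n -> 'I_(@box_size _ n c r).+1}| 1 s D ->
  exists col : I -> 'I_n.+1 * bool, forall b x y,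
    chain (fun A => col A = b) (walk (touching pts (fun=> True)) r) x y ->
    walk (touching pts (fun=> True)) (D * (4 * r + 1)) x y.
Proof.
move=> colorable.
have lambda0 N : 0 < K ^- N by rewrite invr_gt0 exprn_gt0// ltr0n.
have /choice[colN colNP] := fun N =>
  fat_coloring c pts d c0 fatI (K ^- N) (2 * N) r s D (lambda0 N) colorable.
have [U [UU ooU]] := ultraFilterLemma (F := \oo) _.
have /choice[col colP] : forall A, exists b, U [set N | colN N A = b].
  by move=> A; exact: ultra_constant.
exists col => b x y xy.
suff : U [set N | chain (fun A => P N A /\ colN N A = b) (walk (touching pts (P N)) r) x y].
  move=> /filter_ex[N /colNP]; apply: walk_imp => A B [->|[_ _ AB]]; first by left.
  by right.
have good A : col A = b -> U [set N | P N A /\ colN N A = b].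
  by move=> <-; apply: filterI (colP A); apply: ooU; exact: scale_range_eventually.
elim: xy => [A /good|A B C /good gA /walk_eventually/ooU AB _].
  by apply: filterS => N /= PA; exact: chain_one.
move=> BC; apply: filterS (filterI gA (filterI AB BC)) => N [PA [wAB cBC]].
by apply: (chain_cons _ _ _ B).
Qed.

End Truncation.

(** * Covers of intersection graphs from colourings *)

Lemma intersection_coloring {R : realType} (n r : nat) (alpha : R) :
  (0 < n)%N -> 1 <= alpha -> exists D : nat, forall S : set (set 'rV[R]_n),
  (forall A, S A -> [/\ compact A, convex_set A & (aspect_ratio A <= alpha%:E)%E]) ->
  exists col : S -> 'I_n.+1 * bool, forall b x y,
    chain (fun A => col A = b) (walk (touching (fun A : S => val A) (fun=> True)) r) x y ->
    walk (touching (fun A : S => val A) (fun=> True)) D x y.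
Proof.
move=> n0 alpha1.
set c := (alpha * (4 * n%:R * n.+1%:R ^+ 2))^-1.
have c0 : 0 < c by rewrite invr_gt0 !mulr_gt0 ?exprn_gt0 ?ltr0n//; lra.
have [s [D colorable]] :=
  two_colorable_exists #|{ffun 'I_n -> 'I_(@box_size _ n c r).+1}| 1.
exists (D * (4 * r + 1))%N => S SP.
have /choice[d dP] : forall A : S, exists d, fat c (val A) d.
  move=> [A /= /[dup] + SA]; rewrite inE => /SP[cA vA aA].
  exact: bounded_aspect_fat.
exact: (untruncated_coloring c _ d c0 dP r s D colorable).
Qed.

(* Classes of 2r-chains of one colour, thickened by r, remain disjoint. *)
Section Cover.
Context {X : Type} (nd : nat -> X -> X -> Prop) (gnd : graded nd).
Variables (m r D : nat) (col : X -> 'I_m.+1).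
Hypothesis colP : forall b x y,
  chain (fun u => col u = b) (nd (2 * r)) x y -> nd D x y.

Definition thick_class x : set X :=
  [set y | exists2 u, chain (fun u => col u = col x) (nd (2 * r)) x u & nd r u y].

Lemma thick_class_eq x y : col x = col y -> thick_class x `&` thick_class y !=set0 ->
  thick_class x = thick_class y.
Proof.
move=> cxy [z [[u xu uz] [v yv vz]]].
have sy : forall x y, nd (2 * r) x y -> nd (2 * r) y x by exact: (nd_sym _ gnd).
have xy : chain (fun u => col u = col x) (nd (2 * r)) x y.
  apply: (chain_trans xu); apply: chain_cons (chain_sym sy _).
  - exact: chainP_r xu.
  - by rewrite mul2n -addnn; exact: (nd_trans _ gnd) uz (nd_sym _ gnd _ _ _ vz).
  - by rewrite cxy.
apply/seteqP; split=> t [w xw wt]; exists w => //.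
  by rewrite -cxy; apply: chain_trans xw; exact: (chain_sym sy).
by apply: (chain_trans xy); rewrite cxy.
Qed.

Lemma thick_class_diam x y z : thick_class x y -> thick_class x z -> nd (D + 2 * r) y z.
Proof.
move=> [u xu uy] [v xv vz].
have sy : forall x y, nd (2 * r) x y -> nd (2 * r) y x by exact: (nd_sym _ gnd).
have uv : nd D u v := colP _ _ _ (chain_trans (chain_sym sy xu) xv).
have := nd_trans _ gnd _ _ _ _ _ (nd_sym _ gnd _ _ _ uy) (nd_trans _ gnd _ _ _ _ _ uv vz).
by apply: (nd_mono _ gnd); lia.
Qed.

Lemma thick_class_ball x y : nd r x y -> thick_class x y.
Proof. by exists x => //; exact: chain_one. Qed.

End Cover.

Section GraphDistance.
Context {R : realType} {T : Type} (S : set (set T)).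
Let G := intersection_graph S.
Let touch (A B : S) := A = B \/ [/\ True, True & val A `&` val B !=set0].

Lemma graph_dist_le k (A B : S) : walk touch k A B -> (@graph_dist R G A B <= k%:R%:E)%E.
Proof.
move=> AB; have [p [pA lp sp]] : exists p : seq (vertex G),
    [/\ path (@adj G) A p, last A p = B & (size p <= k)%N].
  elim: k A AB => [|k IH] A /= => [->|[Z AZ /IH[p [pZ lp sp]]]]; first by exists [::].
  have [->|neq] := EM (A = Z); first by exists p; split=> //; exact: leqW.
  exists (Z :: p); split=> //=; rewrite pZ andbT; apply/asboolP.
  by case: AZ => [//|[_ _ AZ]].
apply: (@le_trans _ _ (size p)%:R%:E); last by rewrite lee_fin ler_nat.
by apply: ereal_inf_lbound; exists p.
Qed.

(** Path lengths are integers, so a distance below [k.+1] is witnessed by a path with at most [k]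
    edges. *)
Lemma graph_dist_lt k (A B : S) : (@graph_dist R G A B < k.+1%:R%:E)%E -> walk touch k A B.
Proof.
move=> /ereal_inf_lt[_ [p [pA lp] <-]]; rewrite lte_fin ltr_nat ltnS => sp.
have : walk touch (size p) A B.
  elim: p A pA lp {sp} => [|Z p IH] A //= /andP[/asboolP[_ AZ] pZ] lp.
  by exists Z; [right|exact: IH].
apply: (nd_mono _ _ _ _ _ _ sp);
apply: walk_graded => [x|x y [->|[_ _ xy]]]; [by left|by left|right].
by rewrite setIC.
Qed.

End GraphDistance.

Theorem theorem1 (R : realType) (n : nat) (alpha : R) :
  (0 < n)%N -> 1 <= alpha ->
  asdim_at_most R (@convex_intersection_graphs R n alpha) (2 * n + 1).
Proof.
move=> n0 alpha1.
have /choice[Df DfP] := fun r => intersection_coloring n r alpha n0 alpha1.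
pose rad (r : {nonneg R}) := (Num.trunc r%:num).+1.
exists (fun r => (Df (2 * rad r)%N + 2 * rad r)%:R%:nng) => G [S SP ->] r r0.
have [col colP] := DfP (2 * rad r)%N S SP.
set k := rad r in colP *.
set nd := walk _ in colP.
have gnd : graded nd by exact: touching_walk_graded.
(* Dimension [2 * n + 1] allows [2 * n + 2] families, as many as there are pairs of a shift and a
   bit. *)
have code_lt (b : 'I_n.+1 * bool) : (2 * b.1 + b.2 < (2 * n + 1).+1)%N.
  by case: b => -[i /= ?] []; lia.
pose code b := Ordinal (code_lt b).
have code_inj : injective code.
  move=> [[i ?] a] [[j ?] b] /(congr1 val) /= ij; congr (_, _).
    by apply/val_inj => /=; move: ij; case: (a); case: (b); lia.
  by move: ij; case: (a); case: (b); lia.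
pose V := vertex (intersection_graph S).
pose colV (x : V) := code (col x).
have colVP b x y : chain (fun u => colV u = b) (nd (2 * k)%N) x y -> nd (Df (2 * k)%N) x y.
  move=> xy; have xb := chainP_l xy.
  apply: (colP (col x)); apply: chain_imp xy => // u ub.
  by apply: code_inj; rewrite -[LHS]/(colV u) ub -xb.
exists (fun i => [set thick_class nd _ k colV x | x in [set x | colV x = i]]) => U.
have mem x : U (thick_class nd _ k colV x) by exists (colV x) => //; exists x.
split.
- apply/seteqP; split=> // x _; exists (thick_class nd _ k colV x) => //.
  by apply: thick_class_ball; apply: (nd_mono _ gnd 0) => //; exact: (nd_refl _ gnd).
- apply: ge_ereal_sup => _ [_ [i _ [x _ <-]] <-].
  apply: ge_ereal_sup => _ [y [z [xy xz ->]]].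
  by apply: graph_dist_le; exact: (thick_class_diam _ gnd _ _ _ _ colVP x).
- apply: ereal_sup_ubound; exists r%:num => //; split=> // x.
  exists (thick_class nd _ k colV x) => // y xy; apply: thick_class_ball.
  apply: graph_dist_lt; apply: le_lt_trans xy _.
  rewrite lte_fin; apply: lt_le_trans (truncnS_gt _) _.
  by rewrite ler_nat.
- move=> i _ _ [x xi <-] [y yi <-]; apply: thick_class_eq => //.
  by rewrite xi yi.
Qed.
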